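(* Let $A$ be a self-adjoint operator on $\mathcal{H}$ with $Sp(A)\subseteq[m,M]$ for some scalars $0<m<M$, and let $\Phi:\mathcal{B}(\mathcal{H})\to\mathcal{B}(\mathcal{K})$ be a unital positive linear map. For $r\in\mathbb{R}$ put $$\gamma=r(r-1)\cdot\min\left\{m^{r-2},M^{r-2}\right\}$$ and let $K(m,M,r)$ be the generalized Kantorovich constant $$K(m,M,r):=\frac{mM^r-Mm^r}{(r-1)(M-m)}\left(\frac{r-1}{r}\,\frac{M^r-m^r}{mM^r-Mm^r}\right)^r,\qquad K(m,M,0)=K(m,M,1)=1.$$ (i) If $r\in(-\infty,-1)\cup(2,\infty)$, then $$\begin{aligned}\frac{1}{K(m,M,r)}\Phi(A^r)&\le\frac{1}{K(m,M,r)}\left\{\Phi(A^r)+\frac{\gamma}{2}\left[(M+m)\Phi(A)-Mm-\Phi(A^2)\right]\right\}\\&\le\Phi(A)^r\\&\le K(m,M,r)\Phi(A^r)-\frac{\gamma}{2}\left[(M+m)\Phi(A)-Mm-\Phi(A)^2\right]\\&\le K(m,M,r)\Phi(A^r).\end{aligned}$$ (ii) If $r\in[-1,0]\cup[1,2]$, then $$\begin{aligned}\frac{1}{K(m,M,r)}\Phi(A^r)&\le\frac{1}{K(m,M,r)}\left\{\Phi(A^r)+\frac{\gamma}{2}\left[(M+m)\Phi(A)-Mm-\Phi(A^2)\right]\right\}\\&\le\Phi(A)^r\le\Phi(A^r).\end{aligned}$$ (iii) If $r\in[0,1]$, then $$\begin{aligned}\frac{1}{K(m,M,r)}\Phi(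A^r)&\ge\frac{1}{K(m,M,r)}\left\{\Phi(A^r)-\frac{r(1-r)}{2M^{2-r}}\left[(M+m)\Phi(A)-Mm-\Phi(A^2)\right]\right\}\\&\ge\Phi(A)^r\ge\Phi(A^r).\end{aligned}$$
   Context: $\mathcal{H},\mathcal{K}$ are Hilbert spaces and $\mathcal{B}(\mathcal{H})$, $\mathcal{B}(\mathcal{K})$ are the algebras of bounded linear operators on them. A linear map $\Phi$ is positive if it maps positive (semidefinite) operators to positive operators, and unital if $\Phi$ maps the identity to the identity. $Sp(A)$ is the spectrum of $A$, powers are taken by functional calculus, $\le$ is the Loewner order on self-adjoint operators, and scalars in operator expressions denote multiples of the identity. $\Phi(A)^r$ means $(\Phi(A))^r$. *)

(* Defs.v *)
From HB Require Import structures.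
From mathcomp Require Import all_boot all_order all_algebra.
From mathcomp Require Import all_classical all_reals all_analysis.
From mathcomp Require Export complex.

Set Implicit Arguments.
Unset Strict Implicit.
Unset Printing Implicit Defensive.

Import Order.TTheory GRing.Theory Num.Theory.
Import numFieldNormedType.Exports.

Local Open Scope ring_scope.
Local Open Scope complex_scope.

(* A complex Hilbert space: a complete normed space over [R[i]] whose norm comes
   from an inner product.  The norm takes its values in [R[i]] (nonnegative
   reals).  As [hdot] is a {dot}-form for the conjugation, it is linear in its
   first argument and antilinear in the second. *)
HB.mixin Record isHilbert (R : realType) (H : Type)
    of CompleteNormedModule R[i] H := {
  hdot : {dot H for (@Num.conj R[i])};
  hdot_norm : forall x : H, hdot x x = `|x| ^+ 2
}.

#[short(type="hilbertType")]
HB.structure Definition Hilbert (R : realType) :=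
  {H of isHilbert R H & CompleteNormedModule R[i] H}.

Section BoundedOperators.
Context (R : realType) (H : hilbertType R).

Definition bounded_op : {pred (H -> H)} :=
  fun f => `[< linear f /\ exists c : R, forall x, `|f x| <= c%:C * `|x| >].

Record bop := Bop { bop_fun :> H -> H; _ : bop_fun \in bounded_op }.

HB.instance Definition _ := [isSub for bop_fun].
HB.instance Definition _ := gen_eqMixin bop.
HB.instance Definition _ := gen_choiceMixin bop.

Lemma bop_linear (A : bop) : linear A.
Proof. by case: A => f /= /asboolP[]. Qed.

Lemma bop_bounded (A : bop) : exists c : R, forall x, `|A x| <= c%:C * `|x|.
Proof. by case: A => f /= /asboolP[]. Qed.

HB.instance Definition _ (A : bop) :=
  GRing.isLinear.Build R[i] H H *:%R A (bop_linear A).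

Lemma bop_ext (A B : bop) : A =1 B -> A = B.
Proof. by move=> AB; apply: val_inj; apply/funext. Qed.

Lemma bounded_op_submod : submod_closed bounded_op.
Proof.
split=> [|k f g /asboolP[lf [c fc]] /asboolP[lg [d gd]]]; apply/asboolP; split.
- by move=> k x y; rewrite /= scaler0 addr0.
- by exists 0 => x; rewrite normr0 mul0r.
- move=> l x y; rewrite -![(k *: f + g) _]/(k *: f _ + g _) lf lg !scalerDr.
  by rewrite !scalerA [k * l]mulrC addrACA.
- have [u ku] : exists u : R, `|k| = u%:C.
    by exists (complex.Re `|k|); rewrite RRe_real ?normr_real.
  exists (u * c + d) => x.
  rewrite rmorphD rmorphM /= -ku mulrDl -mulrA.
  by rewrite (le_trans (ler_normD _ _)) // lerD // normrZ ler_wpM2l.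
Qed.

HB.instance Definition _ :=
  GRing.isSubmodClosed.Build R[i] (H -> H) bounded_op bounded_op_submod.
HB.instance Definition _ := [SubChoice_isSubLmodule of bop by <:].

Lemma bop1_subproof : idfun \in bounded_op.
Proof.
apply/asboolP; split=> [k x y //|].
by exists 1 => x; rewrite mul1r.
Qed.
Definition bop1 : bop := Bop bop1_subproof.

Lemma bopM_subproof (A B : bop) : A \o B \in bounded_op.
Proof.
apply/asboolP; split=> [k x y /=|]; first by rewrite !linearP.
have [c Ac] := bop_bounded A; have [d Bd] := bop_bounded B.
exists (`|c| * d) => x /=; rewrite (le_trans (Ac _)) //.
rewrite rmorphM /= -mulrA (@le_trans _ _ (`|c|%:C * `|B x|)) //.
  by rewrite ler_wpM2r // lecR ler_norm.
by rewrite ler_wpM2l // lecR.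
Qed.
Definition bopM (A B : bop) : bop := Bop (bopM_subproof A B).

Lemma bopDE (A B : bop) x : (A + B) x = A x + B x.
Proof. by []. Qed.
Lemma bopZE k (A : bop) x : (k *: A) x = k *: A x.
Proof. by []. Qed.

Fact bopMA : associative bopM. Proof. by move=> A B C; exact: bop_ext. Qed.
Fact bop1M : left_id bop1 bopM. Proof. by move=> A; exact: bop_ext. Qed.
Fact bopM1 : right_id bop1 bopM. Proof. by move=> A; exact: bop_ext. Qed.
Fact bopMDl : left_distributive bopM +%R.
Proof. by move=> A B C; exact: bop_ext. Qed.
Fact bopMDr : right_distributive bopM +%R.
Proof. by move=> A B C; apply: bop_ext => x; exact: (linearD A). Qed.

(* Multiplication is composition.  The ring is not declared nontrivial, since
   [H] may be the zero space; this is why [bop] is only an lmodType and a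
   pzRingType, and not an algType. *)
HB.instance Definition _ :=
  GRing.Zmodule_isPzRing.Build bop bopMA bop1M bopM1 bopMDl bopMDr.

Lemma bop1E x : (1 : bop) x = x. Proof. by []. Qed.
Lemma bopME (A B : bop) x : (A * B) x = A (B x). Proof. by []. Qed.

Definition selfadjoint (A : bop) := forall x y : H, hdot (A x) y = hdot x (A y).

(* [0 <= z] in [R[i]] means that [z] is real and nonnegative. *)
Definition positive_op (A : bop) :=
  selfadjoint A /\ forall x : H, 0 <= hdot (A x) x.

Definition loewner_le (A B : bop) :=
  [/\ selfadjoint A, selfadjoint B & positive_op (B - A)].

Definition invertible_op (A : bop) := exists B : bop, A * B = 1 /\ B * A = 1.

Definition scalar_op (z : R[i]) : bop := z *: (1 : bop).

Definition spectrum (A : bop) : set R[i] :=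
  [set z : R[i] | ~ invertible_op (A - scalar_op z)].

Definition poly_op (p : {poly R}) (A : bop) : bop :=
  \sum_(i < size p) (p`_i)%:C *: A ^+ i.

(* Continuous functional calculus of a self-adjoint [A] (so that the spectrum is
   real): [B] is the operator-norm limit of operators [p A], for real
   polynomials [p] converging to [f] uniformly on the spectrum of [A].  The last
   condition says that the operator norm of [poly_op p A - B] is at most [e]. *)
Definition is_funcalc (f : R -> R) (A B : bop) :=
  forall e : R, 0 < e -> exists p : {poly R},
    (forall t : R, spectrum A t%:C -> `|p.[t] - f t| <= e) /\
    (forall x : H, `|(poly_op p A - B) x| <= e%:C * `|x|).

(* [f(A)]; the value 0 is taken if there is no such operator, which does not
   happen for self-adjoint [A] and [f] continuous on the spectrum. *)
Definition funcalc (f : R -> R) (A : bop) : bop :=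
  xget 0 [set B | is_funcalc f A B]%classic.

Definition op_powR (A : bop) (r : R) : bop := funcalc (fun t => t `^ r) A.

End BoundedOperators.

Arguments bop {R} H.
Arguments scalar_op {R H} z.

Definition positive_map (R : realType) (H K : hilbertType R)
    (Phi : bop H -> bop K) :=
  forall A : bop H, positive_op A -> positive_op (Phi A).

Definition unital_map (R : realType) (H K : hilbertType R)
    (Phi : bop H -> bop K) := Phi 1 = 1.

Definition kantorovich (R : realType) (m M r : R) : R :=
  if (r == 0) || (r == 1) then 1 else
  (m * M `^ r - M * m `^ r) / ((r - 1) * (M - m)) *
  ((r - 1) / r * ((M `^ r - m `^ r) / (m * M `^ r - M * m `^ r))) `^ r.

Declare Scope loewner_scope.
Delimit Scope loewner_scope with loewner.
Notation "A <=L B" := (loewner_le A B)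
  (at level 70, B at next level, no associativity) : loewner_scope.
Notation "A ^oR r" := (op_powR A r)
  (at level 29, left associativity) : loewner_scope.

(* Main.v *)
(** The function [t `^ r] has second derivative at least [gamma] on [[m, M]]
    when [r] is outside [(0, 1)], so with its chord [L] it satisfies
    [t `^ r + gamma / 2 * (M - t) * (t - m) <= L t], while Bernoulli's inequality
    gives [L t <= K(m,M,r) * t `^ r].  Applying these to [A] and then [Phi], or
    directly to [Phi A], and using that [Phi] commutes with the affine [L], yields
    every inequality in which the constant occurs; for [r] in [[0, 1]] the signs
    are reversed.

    The remaining inequalities are Jensen's inequality for operator convex powers
    and positive, not necessarily completely positive, maps.  Bernstein
    polynomials [b_i] with nodes [t_i] turn [A] into the discrete resolution
    [Q_i = Phi (b_i(A)) >= 0], with [\sum Q_i = 1] and [\sum t_i Q_i = Phi A], for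
    which Jensen's inequality for [1 / (l + t)] is an explicit square.  The powers
    with exponent in [[-1, 0]] are uniform limits of positive combinations of such
    functions, and multiplying by [t] or [t ^ 2] gives the other exponents. *)

Require Import Defs.
From HB Require Import structures.
From mathcomp Require Import all_boot all_order all_algebra.
From mathcomp Require Import all_classical all_reals all_analysis.
From mathcomp Require Import ring lra.

Set Implicit Arguments.
Unset Strict Implicit.
Unset Printing Implicit Defensive.

Import Order.TTheory GRing.Theory Num.Theory.
Import numFieldNormedType.Exports.

Local Open Scope ring_scope.
Local Open Scope complex_scope.
Local Open Scope loewner_scope.

(** * Real powers *)

(** The functional calculus is given only as a norm limit of polynomials, so f(A) is never computed:
    it is compared with polynomials in [A] through real quadratic forms, and such comparisons
    survive [Phi]. Since the chord and (M - t)(t - m) are polynomials, this suffices. It rests on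
    one spectral fact: a real polynomial that is nonnegative on the spectrum of [A] has a
    nonnegative form at [A]. A Neumann series and the factorization of complex polynomials into
    linear factors give it.

    [Phi] is not multiplicative, which is the obstacle to Jensen's inequality; the family Q_i
    retains from [Phi] only positivity, total mass and first moment. Completing the square for 1/(l
    + t) calls for the inverse of l + T. A polynomial in [T] takes its place, at the cost of the
    tolerance in [jensen].

    The sums of resolvents discretize the integral of x^s / (x + t) over x > 0, a multiple of t^s
    for -1 < s < 0, along powers of a ratio q. Normalizing the sum at t = m avoids evaluating the
    integral. *)

Section RealPowers.
Context (R : realType).
Implicit Types (a b c m M r s t x y : R).

(** Add ln u <= u - 1 at u = s/c and at u = 1/c with weights r and 1 - r, where c is the right-hand
    side: the bounds cancel and leave r ln s <= ln c. *)
Lemma bernoulli_powR_le r s :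
  0 < s -> 0 <= r <= 1 -> s `^ r <= 1 + r * (s - 1).
Proof.
move=> s0 /andP[r0 r1]; set c := 1 + r * (s - 1).
have c0 : 0 < c by rewrite /c; nra.
have ln_le (u : R) : 0 < u -> ln u <= u - 1.
  by move=> u0; have := @le_ln1Dx R (u - 1); rewrite subrKC; apply; lra.
rewrite -ler_ln ?posrE ?powR_gt0// ln_powR.
have h1 := ln_le _ (divr_gt0 s0 c0); have h2 := ln_le c^-1.
rewrite ln_div ?posrE// in h1; rewrite lnV ?posrE// invr_gt0 in h2.
have {}h2 := h2 c0.
have e : r * (s / c - 1) + (1 - r) * (c^-1 - 1) = 0.
  by apply: (mulIf (lt0r_neq0 c0)); rewrite /c; field; exact: lt0r_neq0.
nra.
Qed.

(** Both ranges reduce to [bernoulli_powR_le]: for 1 <= r, with exponent 1/r at s^r; for r <= 0,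
    with exponent 1/(1 - r) at s^(r - 1), whose power is 1/s. *)
Lemma bernoulli_powR_ge r s :
  0 < s -> r <= 0 \/ 1 <= r -> 1 + r * (s - 1) <= s `^ r.
Proof.
move=> s0 [r0|r1].
- have v0 : 0 < s `^ r by exact: powR_gt0.
  set w := (1 - r)^-1.
  have w0 : 0 < w by rewrite /w invr_gt0; lra.
  have w1 : w <= 1 by rewrite /w invf_le1; lra.
  have /(@bernoulli_powR_le w) := divr_gt0 v0 s0.
  rewrite (ltW w0) w1 => /(_ isT).
  have -> : (s `^ r / s) `^ w = s^-1.
    have -> : s `^ r / s = s `^ (r - 1).
      by rewrite powRB ?(gt_eqF s0) ?implybT// powRr1// ltW.
    rewrite -powRrM -powR_inv1 ?(ltW s0)//; congr (_ `^ _).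
    by rewrite /w; field; lra.
  move=> h; have {}h : s * (1 - r) * s^-1 <= s * (1 - r) * (1 + w * (s `^ r / s - 1)).
    by rewrite ler_wpM2l//; apply: mulr_ge0; lra.
  have e1 : s * (1 - r) * s^-1 = 1 - r by field; lra.
  have e2 : s * (1 - r) * (1 + w * (s `^ r / s - 1)) = s * (1 - r) + s `^ r - s.
    by rewrite /w; field; lra.
  lra.
- have r0 : 0 < r by lra.
  have /(@bernoulli_powR_le r^-1) := @powR_gt0 _ s r s0.
  rewrite -powRrM divff ?(gt_eqF r0)// powRr1 ?(ltW s0)// invr_ge0 (ltW r0) invf_le1//.
  move=> /(_ r1) h.
  have {}h : r * s <= r * (1 + r^-1 * (s `^ r - 1)) by rewrite ler_wpM2l// ltW.
  have e : r * (1 + r^-1 * (s `^ r - 1)) = r + s `^ r - 1 by field; lra.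
  lra.
Qed.

(** The subtracted quadratic has second derivative [c], so that a curvature bound by [c] can be used
    as plain convexity. *)
Lemma powR_quad_mvt r c a b : 0 < a -> a < b ->
  exists2 x, a < x < b & (b `^ r - c / 2 * b ^+ 2) - (a `^ r - c / 2 * a ^+ 2) =
    (r * x `^ (r - 1) - c * x) * (b - a).
Proof.
move=> a0 ab.
pose f x := x `^ r - c / 2 * x ^+ 2.
have df x : 0 < x -> is_derive x 1 f (r * x `^ (r - 1) - c * x).
  move=> x0; have h := is_derive1_powR r x0.
  rewrite /f; apply: is_derive_eq.
  rewrite /= -![_ *: _]/(_ * _).
  by field.
have [||x xab e] := @MVT _ f (fun x => r * x `^ (r - 1) - c * x) a b ab.
- by move=> x; rewrite in_itv/= => /andP[ax _]; apply: df; lra.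
- apply: derivable_within_continuous => x; rewrite in_itv/= => /andP[ax _].
  by apply: ex_derive; apply: df; lra.
by exists x => //; move: xab; rewrite in_itv.
Qed.

End RealPowers.

(** * Chords of powers and the Kantorovich constant *)

Section PowerChords.
Context (R : realType).
Implicit Types (a c m M r x y : R).

Lemma le0_ler_powR a x y : a <= 0 -> 0 < x -> x <= y -> y `^ a <= x `^ a.
Proof.
move=> a0 x0 xy; have y0 := lt_le_trans x0 xy.
rewrite -[a]opprK !(powRN _ (- a)) lef_pV2 ?posrE ?powR_gt0//.
by apply: ge0_ler_powR; rewrite ?nnegrE ?oppr_ge0// ltW.
Qed.

Lemma powR_bound a m M x : 0 < m -> m <= x <= M ->
  Num.min (m `^ a) (M `^ a) <= x `^ a <= Num.max (m `^ a) (M `^ a).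
Proof.
move=> m0 /andP[mx xM]; have x0 : 0 < x by lra.
have M0 : 0 < M by lra.
have [a0|a0] := leP 0 a.
  have h u v : 0 < u -> u <= v -> u `^ a <= v `^ a.
    by move=> u0 uv; apply: ge0_ler_powR; rewrite ?nnegrE//; lra.
  by rewrite ge_min le_max (h m x)// (h x M)// orbT.
have h u v := @le0_ler_powR a u v (ltW a0).
by rewrite ge_min le_max (h m x)// (h x M)// orbT.
Qed.

Lemma powR_mvt r a b : 0 < a -> a < b ->
  exists2 x, a < x < b & b `^ r - a `^ r = r * x `^ (r - 1) * (b - a).
Proof.
move=> a0 ab; have [x xab] := powR_quad_mvt r 0 a0 ab.
by rewrite !mul0r !subr0 => e; exists x.
Qed.

Lemma powR_lipschitz r m M : 0 < m -> exists2 L, 0 <= L &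
  forall s t, m <= s <= M -> m <= t <= M -> `|s `^ r - t `^ r| <= L * `|s - t|.
Proof.
move=> m0; exists (`|r| * Num.max (m `^ (r - 1)) (M `^ (r - 1))).
  by rewrite mulr_ge0// le_max powR_ge0.
move=> s t; wlog : s t / t < s => [wl|st] sm tm.
  have [st|ts|->] := ltgtP s t.
  - by rewrite distrC [`|s - t|]distrC; apply: wl.
  - exact: wl.
  - by rewrite !subrr !normr0 mulr0.
have [|x xts ->] := @powR_mvt r t s _ st; first by lra.
rewrite !normrM ler_wpM2r// ler_wpM2l//.
rewrite ger0_norm ?powR_ge0//.
by have /andP[] := @powR_bound (r - 1) m M x m0 ltac:(lra).
Qed.

Definition powR_chord m M r x :=
  ((M - x) * m `^ r + (x - m) * M `^ r) / (M - m).

(** The function sg t^r - (c/2) t^2 is convex on [m, M], hence below its chord, and (M - x)(x - m)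
    is the excess of the chord of t^2 over t^2. Convexity enters by comparing the derivatives at
    mean value points u < x < v. The sign [sg] treats convex and concave powers at once. *)
Lemma powR_chord_curvature m M r sg c x : 0 < m -> m < M -> sg ^+ 2 = 1 ->
  (forall y, m <= y <= M -> c <= sg * (r * (r - 1)) * y `^ (r - 2)) ->
  m <= x <= M ->
  sg * x `^ r + c / 2 * ((M - x) * (x - m)) <= sg * powR_chord m M r x.
Proof.
move=> m0 mM sg1 hc /andP[]; rewrite /powR_chord.
rewrite le_eqVlt => /predU1P[<- _|mx].
  by rewrite subrr !(mul0r, mulr0, addr0) mulrAC divff ?mul1r// subr_eq0 gt_eqF.
rewrite le_eqVlt => /predU1P[->|xM].
  by rewrite subrr !(mul0r, mulr0, addr0, add0r) mulrAC divff ?mul1r// subr_eq0 gt_eqF.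
have x0 : 0 < x by lra.
have [u mux eu] := powR_quad_mvt r (sg * c) m0 mx.
have [v xvM ev] := powR_quad_mvt r (sg * c) x0 xM.
have [w uwv ew] := @powR_mvt (r - 1) u v ltac:(lra) ltac:(lra).
have {hc} cw : c <= sg * (r * (r - 1)) * w `^ (r - 2) by apply: hc; lra.
have er : r - 1 - 1 = r - 2 by lra.
rewrite {}er in ew.
set W := w `^ _ in ew cw.
set U := u `^ _ in eu ew; set V := v `^ _ in ev ew.
have duv : 0 <= sg * (r * (V - U)) - c * (v - u).
  rewrite ew; have -> : sg * (r * ((r - 1) * W * (v - u))) - c * (v - u) =
    (sg * (r * (r - 1)) * W - c) * (v - u) by ring.
  by apply: mulr_ge0; lra.
rewrite [leRHS]mulrA ler_pdivlMr ?subr_gt0//.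
set X := x `^ r in eu ev *; set A := m `^ r in eu *; set B := M `^ r in ev *.
have eX : sg * ((M - x) * A + (x - m) * B) -
   (sg * X + c / 2 * ((M - x) * (x - m))) * (M - m) =
   (M - x) * (x - m) * (sg * (r * (V - U)) - c * (v - u)).
  have hB : B = X - sg * c / 2 * x ^+ 2 + sg * c / 2 * M ^+ 2 + (r * V - sg * c * v) * (M - x).
    by rewrite -ev; ring.
  have hA : A = X - sg * c / 2 * x ^+ 2 + sg * c / 2 * m ^+ 2 - (r * U - sg * c * u) * (x - m).
    by rewrite -eu; ring.
  rewrite hA hB.
  rewrite -[in RHS](mul1r c) -[in LHS](mul1r (c / 2)) -sg1; ring.
rewrite -subr_ge0 eX; apply: mulr_ge0 => //; nra.
Qed.

(** Dividing by the exponent absorbs the sign of the increment; exponents r - 1 and r then give the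
    signs of [beta] and [sigma]. *)
Lemma powR_slope_gt0 r m M : 0 < m -> m < M -> r != 0 -> 0 < (M `^ r - m `^ r) / r.
Proof.
move=> m0 mM r0; have [x xm ->] := powR_mvt r m0 mM.
have -> : r * x `^ (r - 1) * (M - m) / r = x `^ (r - 1) * (M - m) by field.
by rewrite mulr_gt0 ?powR_gt0 ?subr_gt0//; lra.
Qed.

Section Kantorovich.
Variables (m M r : R).
Hypotheses (m0 : 0 < m) (mM : m < M).

Let M0 : 0 < M. Proof. exact: lt_trans mM. Qed.
Let mM0 : M - m != 0. Proof. by rewrite subr_eq0 gt_eqF. Qed.

(** For r other than 0 and 1, the curve K(m,M,r) t^r touches the chord of t^r at t = 1/sigma, where
    both take the value [beta]. *)
Let beta := (m * M `^ r - M * m `^ r) / ((r - 1) * (M - m)).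
Let sigma := (r - 1) / r * ((M `^ r - m `^ r) / (m * M `^ r - M * m `^ r)).

Let kE : r != 0 -> r != 1 -> kantorovich m M r = beta * sigma `^ r.
Proof. by rewrite /kantorovich => /negbTE-> /negbTE->. Qed.

Let beta_gt0 : r != 1 -> 0 < beta.
Proof.
move=> r1; have h := @powR_slope_gt0 (r - 1) m M m0 mM.
rewrite subr_eq0 in h; have {}h := h r1.
have e u : 0 < u -> u `^ r = u * u `^ (r - 1).
  by move=> u0; rewrite powRB ?(gt_eqF u0) ?implybT// powRr1 ?(ltW u0)//; field; lra.
(* The numerator of [beta] is m M times the increment of t^(r - 1). *)
have -> : beta = m * M / (M - m) * ((M `^ (r - 1) - m `^ (r - 1)) / (r - 1)).
  by rewrite /beta (e m)// (e M)//; field; rewrite mM0 subr_eq0 r1.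
by rewrite mulr_gt0// divr_gt0 ?mulr_gt0// subr_gt0.
Qed.

Let sigma_gt0 : r != 0 -> r != 1 -> 0 < sigma.
Proof.
move=> r0 r1.
have h1 := powR_slope_gt0 m0 mM r0; have h2 := beta_gt0 r1.
have h3 : m * M `^ r - M * m `^ r != 0.
  by apply: contraTneq h2 => h; rewrite /beta h mul0r ltxx.
have -> : sigma = ((M `^ r - m `^ r) / r) / (M - m) / beta.
  by rewrite /sigma /beta; field; rewrite r0 mM0 h3 subr_eq0 r1.
by rewrite divr_gt0// divr_gt0// subr_gt0.
Qed.

Lemma kantorovich_gt0 : 0 < kantorovich m M r.
Proof.
have [r0|r0] := eqVneq r 0; first by rewrite /kantorovich r0 eqxx.
have [r1|r1] := eqVneq r 1; first by rewrite /kantorovich r1 eqxx orbT.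
by rewrite kE// mulr_gt0 ?beta_gt0 ?powR_gt0 ?sigma_gt0.
Qed.

Let chordE x : r != 0 -> r != 1 ->
  powR_chord m M r x = beta * (1 + r * (sigma * x - 1)).
Proof.
move=> r0 r1; have h2 := beta_gt0 r1; have h3 : m * M `^ r - M * m `^ r != 0.
  by apply: contraTneq h2 => h; rewrite /beta h mul0r ltxx.
by rewrite /powR_chord /beta /sigma; field; rewrite r0 mM0 h3 subr_eq0 r1.
Qed.

Let kxE x : 0 < x -> r != 0 -> r != 1 ->
  kantorovich m M r * x `^ r = beta * (sigma * x) `^ r.
Proof.
move=> x0 r0 r1; rewrite kE// -mulrA -powRM// ?(ltW x0)//.
by rewrite ltW ?sigma_gt0.
Qed.

Let kantorovich01 x : 0 < x -> r == 0 \/ r == 1 ->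
  powR_chord m M r x = kantorovich m M r * x `^ r.
Proof.
move=> x0 [] /eqP->; rewrite /powR_chord /kantorovich eqxx ?orbT /= mul1r.
  by rewrite !powRr0; field.
by rewrite !powRr1 ?ltW//; field.
Qed.

(* After factoring [kantorovich m M r * x `^ r] as [beta * (sigma * x) `^ r],
   the chord is [beta] times the tangent line in Bernoulli's inequality. *)
Lemma kantorovich_ge_chord x : 0 < x -> r <= 0 \/ 1 <= r ->
  powR_chord m M r x <= kantorovich m M r * x `^ r.
Proof.
move=> x0 hr; have [r0|r0] := eqVneq r 0.
  by rewrite kantorovich01// r0 eqxx; left.
have [r1|r1] := eqVneq r 1; first by rewrite kantorovich01// r1 eqxx; right.
rewrite chordE// kxE// ler_wpM2l ?(ltW (beta_gt0 r1))//.
by apply: bernoulli_powR_ge => //; rewrite mulr_gt0 ?sigma_gt0.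
Qed.

Lemma kantorovich_le_chord x : 0 < x -> 0 <= r <= 1 ->
  kantorovich m M r * x `^ r <= powR_chord m M r x.
Proof.
move=> x0 hr; have [r0|r0] := eqVneq r 0.
  by rewrite kantorovich01// r0 eqxx; left.
have [r1|r1] := eqVneq r 1; first by rewrite kantorovich01// r1 eqxx; right.
rewrite chordE// kxE// ler_wpM2l ?(ltW (beta_gt0 r1))//.
by apply: bernoulli_powR_le => //; rewrite mulr_gt0 ?sigma_gt0.
Qed.

End Kantorovich.

End PowerChords.

(** * Bernstein polynomials *)

Section Bernstein.

(** The absorption identity i C(n+1, i) = (n+1) C(n, i-1) removes one factor of the index. The free
    weight [g] allows a second application, for the second factorial moment. *)
Lemma bernstein_shift (S : comNzRingType) (u v : S) n (g : nat -> nat) :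
  \sum_(i < n.+2) (u ^+ i * v ^+ (n.+1 - i)) *+ ('C(n.+1, i) * (i * g i.-1)) =
  (u * \sum_(i < n.+1) (u ^+ i * v ^+ (n - i)) *+ ('C(n, i) * g i)) *+ n.+1.
Proof.
rewrite big_ord_recl /= mul0n muln0 mulr0n add0r mulr_sumr -sumrMnl.
apply: eq_bigr => i _; rewrite /bump /= add1n subSS exprS -mulrA mulrnAr -mulrnA.
congr (_ *+ _).
by rewrite mulnA [('C(_, _) * _)%N]mulnC -mul_bin_diag [RHS]mulnC mulnA.
Qed.

Lemma bernstein_sum (S : comNzRingType) (u v : S) n : u + v = 1 ->
  \sum_(i < n.+1) (u ^+ i * v ^+ (n - i)) *+ 'C(n, i) = 1.
Proof.
move=> uv; rewrite -(expr1n _ n) -uv addrC exprDn.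
by apply: eq_bigr => i _; rewrite mulrC.
Qed.

Lemma bernstein_sum1 (S : comNzRingType) (u v : S) n : u + v = 1 ->
  \sum_(i < n.+2) (u ^+ i * v ^+ (n.+1 - i)) *+ ('C(n.+1, i) * i) = u *+ n.+1.
Proof.
move=> uv; rewrite -[in RHS](mulr1 u) -(bernstein_sum n uv).
under [in RHS]eq_bigr do rewrite -[in X in _ *+ X](muln1 'C(_, _)).
rewrite -(bernstein_shift _ _ _ (fun=> 1%N)).
by apply: eq_bigr => i _; rewrite muln1.
Qed.

Lemma bernstein_sum2 (S : comNzRingType) (u v : S) n : u + v = 1 ->
  \sum_(i < n.+3) (u ^+ i * v ^+ (n.+2 - i)) *+ ('C(n.+2, i) * (i * i.-1)) =
  (u ^+ 2 *+ n.+1) *+ n.+2.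
Proof.
move=> uv; rewrite (bernstein_shift _ _ _ id) bernstein_sum1//.
by rewrite mulrnAr.
Qed.

Context (R : realType).
Implicit Types (m M L e : R).

Lemma bernstein_variance (u v : R) n : u + v = 1 ->
  \sum_(i < n.+3) (i%:R / n.+2%:R - u) ^+ 2 *
     ((u ^+ i * v ^+ (n.+2 - i)) *+ 'C(n.+2, i)) = u * v / n.+2%:R.
Proof.
move=> uv; set b := fun i : 'I_n.+3 => (u ^+ i * v ^+ (n.+2 - i)) *+ 'C(n.+2, i).
set N : R := n.+2%:R; have N0 : N != 0 by rewrite pnatr_eq0.
have nN : n.+1%:R = N - 1 :> R by rewrite /N [in RHS]mulrSr addrK.
(* The square is expanded in the falling factorials 1, i and i (i - 1), whose moments are known. *)
transitivity (\sum_(i < n.+3) ((u ^+ i * v ^+ (n.+2 - i)) *+ ('C(n.+2, i) * (i * i.-1)) / N ^+ 2 +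
   (u ^+ i * v ^+ (n.+2 - i)) *+ ('C(n.+2, i) * i) * (1 / N ^+ 2 - 2 * u / N)
   + u ^+ 2 * b i)).
  apply: eq_bigr => i _.
  have bE k : (u ^+ i * v ^+ (n.+2 - i)) *+ ('C(n.+2, i) * k) = b i * k%:R.
    by rewrite mulrnA mulr_natr.
  rewrite !bE natrM -/(b i).
  have -> : (i : nat)%:R * (i.-1)%:R = (i : nat)%:R * ((i : nat)%:R - 1) :> R.
    by case: (nat_of_ord i) => [|j]; rewrite ?mul0r//= -[X in X - 1]natr1 addrK.
  by field.
rewrite !big_split /= -!mulr_suml -mulr_sumr bernstein_sum2// bernstein_sum1//.
rewrite /b bernstein_sum// -[_ *+ n.+1 *+ _]mulr_natr -[u ^+ 2 *+ _]mulr_natr.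
rewrite -[u *+ _]mulr_natr nN -/N.
have -> : v = 1 - u by rewrite -uv addrAC subrr add0r.
by field.
Qed.

(** Besides approximating [f], the basis is nonnegative on [m, M] and reproduces 1 and 'X exactly.
    These are the properties that a unital positive map carries over to the operators b_i(A). *)
Lemma bernstein_approx m M (f : R -> R) L e : m < M -> 0 < e ->
  (forall s t, m <= s <= M -> m <= t <= M -> `|f s - f t| <= L * `|s - t|) ->
  exists n (t : 'I_n -> R) (b : 'I_n -> {poly R}),
  [/\ (forall i, m <= t i <= M),
      (forall i s, m <= s <= M -> 0 <= (b i).[s]),
      \sum_i b i = 1, \sum_i t i *: b i = 'X &
      forall s, m <= s <= M -> `|(\sum_i f (t i) *: b i).[s] - f s| <= e].
Proof.
move=> mM e0 fL.
have dM : 0 < M - m by rewrite subr_gt0.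
set d := M - m in dM.
(* A degree of at least [C] makes the variance term at the end of the proof at most e/2. *)
pose C := 2 * (L ^+ 2 * d ^+ 2 / (e / 2)) / e.
pose n := Num.truncn C.
have nC : L ^+ 2 * d ^+ 2 / (e / 2) <= (e / 2) * n.+2%:R.
  have : C <= n.+2%:R.
    by apply: ltW; apply: lt_trans (truncnS_gt _) _; rewrite ltr_nat.
  by rewrite /C ler_pdivrMr// => ?; lra.
set N : R := n.+2%:R in nC; have N0 : 0 < N by rewrite ltr0n.
have [u du us] : exists2 u : {poly R}, d *: u = 'X - m%:P &
    forall s, u.[s] = (s - m) / d.
  exists (d^-1 *: ('X - m%:P)).
    by rewrite scalerA divff ?scale1r// gt_eqF.
  by move=> s; rewrite !hornerE mulrC.
have [v uv vs] : exists2 v : {poly R}, u + v = 1 &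
    forall s, v.[s] = (M - s) / d.
  exists (1 - u) => [|s]; first by rewrite subrKC.
  by rewrite hornerD hornerN us -polyC1 hornerC /d; field; rewrite gt_eqF.
exists n.+3, (fun i => m + d * (i%:R / N)).
exists (fun i => (u ^+ i * v ^+ (n.+2 - i)) *+ 'C(n.+2, i)).
have bs i s : ((u ^+ i * v ^+ (n.+2 - i)) *+ 'C(n.+2, i)).[s] =
  (u.[s] ^+ i * v.[s] ^+ (n.+2 - i)) *+ 'C(n.+2, i).
  by rewrite hornerMn hornerM !horner_exp.
have tm (i : 'I_n.+3) : m <= m + d * (i%:R / N) <= M.
  have i0 : 0 <= i%:R / N by rewrite divr_ge0// ltW.
  have i1 : i%:R / N <= 1 by rewrite ler_pdivrMr// mul1r ler_nat -ltnS.
  have : m + d = M by rewrite subrKC.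
  by move=> <-; rewrite lerDl mulr_ge0 ?(ltW dM)//= lerD2l ler_piMr// ltW.
have b0 (i : 'I_n.+3) s : m <= s <= M ->
    0 <= ((u ^+ i * v ^+ (n.+2 - i)) *+ 'C(n.+2, i)).[s].
  move=> /andP[ms sM]; rewrite bs mulrn_wge0// mulr_ge0// exprn_ge0// ?us ?vs;
  by rewrite divr_ge0 ?subr_ge0// ltW.
have b1 := @bernstein_sum _ u v n.+2 uv.
split=> //.
  under eq_bigr do rewrite scalerDl; rewrite big_split /= -scaler_sumr b1.
  transitivity (m *: 1 + (d / N) *: \sum_(i < n.+3)
      (u ^+ i * v ^+ (n.+2 - i)) *+ ('C(n.+2, i) * i)).
    congr (_ + _); rewrite scaler_sumr; apply: eq_bigr => i _.
    by rewrite mulrnA -[X in _ = _ *: X]scaler_nat scalerA mulrA mulrAC.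
  rewrite bernstein_sum1// -scaler_nat !scalerA -/N divfK ?gt_eqF// du.
  by rewrite -alg_polyC addrC subrK.
move=> s sM.
have -> : f s = \sum_(i < n.+3) f s * ((u ^+ i * v ^+ (n.+2 - i)) *+ 'C(n.+2, i)).[s].
  by rewrite -mulr_sumr -horner_sum b1 hornerE mulr1.
rewrite horner_sum -sumrB; apply: le_trans (ler_norm_sum _ _ _) _.
have us1 : u.[s] + v.[s] = 1 by rewrite -hornerD uv hornerE.
pose c := L ^+ 2 * d ^+ 2 / (e / 2).
have e2 : 0 < e / 2 by lra.
have c0 : 0 <= c by apply: divr_ge0; [rewrite mulr_ge0 ?sqr_ge0|exact: ltW].
(* By y <= e/2 + y^2 / (e/2), the Lipschitz error is bounded by a constant and a square; the
   constant sums to e/2 and the squares to the variance. *)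
apply: (@le_trans _ _ (\sum_(i < n.+3) (e / 2 + c * (i%:R / N - u.[s]) ^+ 2) *
    ((u ^+ i * v ^+ (n.+2 - i)) *+ 'C(n.+2, i)).[s])).
  apply: ler_sum => i _; rewrite hornerZ -mulrBl normrM.
  rewrite (ger0_norm (b0 _ _ sM)) ler_wpM2r// ?b0//.
  apply: le_trans (fL _ _ (tm i) sM) _.
  have -> : m + d * (i%:R / N) - s = d * (i%:R / N - u.[s]).
    by rewrite us; field; rewrite !gt_eqF.
  rewrite normrM (gtr0_norm dM) /c.
  set z := `|_ - _|; have -> : (i%:R / N - u.[s]) ^+ 2 = z ^+ 2 by rewrite /z real_normK// num_real.
  rewrite -subr_ge0; set y := L * (d * z).
  have -> : e / 2 + L ^+ 2 * d ^+ 2 / (e / 2) * z ^+ 2 - y =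
      ((e / 2 - y) ^+ 2 + e / 2 * y) / (e / 2).
    by rewrite /y; field; rewrite gt_eqF.
  have [y0|y0] := leP 0 y; first by rewrite divr_ge0 ?(ltW e2)// addr_ge0 ?sqr_ge0// mulr_ge0// ltW.
  rewrite divr_ge0 ?(ltW e2)//; nra.
under eq_bigr do rewrite mulrDl bs -[c * _ * _]mulrA.
rewrite big_split /= -!mulr_sumr bernstein_variance// bernstein_sum//.
have uv1 : u.[s] * v.[s] <= 1.
  have -> : v.[s] = 1 - u.[s] by rewrite -us1 addrAC subrr add0r.
  nra.
rewrite mulr1 -/N.
have : c * (u.[s] * v.[s] / N) <= e / 2; last by move: (c * _) => q; lra.
rewrite mulrA ler_pdivrMr//; apply: le_trans nC.
rewrite -/c; nra.
Qed.

End Bernstein.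

(** * Powers as limits of sums of resolvents *)

Section ResolventSums.
Context (R : realType).
Implicit Types (q w m M s t e : R) (N : nat).

(** The nodes are q^(i - N) for -N <= i - N <= N. With w = q^(s + 1), the weights w^(i - N) are
    those of x^s dx on a geometric grid, up to a constant factor. *)
Definition resolvent_sum q w N t :=
  \sum_(i < (N + N).+1) (w ^+ i / w ^+ N) / (q ^+ i / q ^+ N + t).

(** Term i + 1 at q t is w/q times term i at t. Only the first term on the left and the last one on
    the right remain, and they give the two errors. *)
Lemma resolvent_sum_shift q w m N t : 1 < w -> w < q -> 0 < m -> m <= t ->
  `|resolvent_sum q w N (q * t) - w / q * resolvent_sum q w N t| <=
  (w^-1) ^+ N / m + (w / q) ^+ N.
Proof.
move=> w1 wq m0 mt; have w0 : 0 < w by lra.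
have q0 : 0 < q by lra.
have t0 : 0 < t by lra.
have wn i : 0 < w ^+ i by exact: exprn_gt0.
have qn i : 0 < q ^+ i by exact: exprn_gt0.
have qN i : 0 < q ^+ i / q ^+ N by exact: divr_gt0.
rewrite /resolvent_sum big_ord_recl [X in w / q * X]big_ord_recr /=.
have -> : \sum_(i < N + N) (w ^+ bump 0 i / w ^+ N) / (q ^+ bump 0 i / q ^+ N + q * t) =
  w / q * \sum_(i < N + N) (w ^+ i / w ^+ N) / (q ^+ i / q ^+ N + t).
  rewrite mulr_sumr; apply: eq_bigr => i _; rewrite /bump /= add1n !exprS.
  have h : q ^+ i + t * q ^+ N != 0 by rewrite gt_eqF// addr_gt0// mulr_gt0.
  by field; rewrite ?mulf_neq0 ?gt_eqF//= ?addr_gt0 ?mulr_gt0.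
rewrite mulrDr opprD addrA addrK !expr0.
apply: le_trans (ler_normB _ _) _; apply: lerD.
  rewrite ger0_norm; last first.
    by rewrite ltW// divr_gt0 ?addr_gt0 ?divr_gt0 ?mulr_gt0.
  rewrite exprVn mul1r; apply: ler_wpM2l; first by rewrite invr_ge0 ltW.
  rewrite lef_pV2 ?posrE ?addr_gt0 ?divr_gt0 ?mulr_gt0//.
  have : 0 < 1 / q ^+ N by rewrite divr_gt0.
  nra.
rewrite ger0_norm; last first.
  by rewrite ltW// mulr_gt0// ?divr_gt0// ?addr_gt0// ?divr_gt0.
rewrite !exprD !mulfK ?gt_eqF// expr_div_n.
have h : w ^+ N / (q ^+ N + t) <= w ^+ N / q ^+ N.
  by rewrite ler_wpM2l ?(ltW (wn N))// lef_pV2 ?posrE ?addr_gt0// lerDl ltW.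
apply: le_trans h; rewrite ler_piMl ?divr_ge0 ?addr_ge0// ?ltW//.
by rewrite ltr_pdivrMr// mul1r.
Qed.

Lemma resolvent_sum_anti q w N s t : 0 < q -> 0 < w -> 0 < s -> s <= t ->
  resolvent_sum q w N t <= resolvent_sum q w N s.
Proof.
move=> q0 w0 s0 st; apply: ler_sum => i _.
have qi : 0 < q ^+ i / q ^+ N by rewrite divr_gt0 ?exprn_gt0.
rewrite ler_wpM2l ?divr_ge0 ?exprn_ge0// ?(ltW w0)//.
by rewrite lef_pV2 ?posrE; lra.
Qed.

(** The middle term has node 1 and weight 1. The bound is uniform in [N], so the constant that
    normalizes the sum stays bounded as [N] grows. *)
Lemma resolvent_sum_ge q w N t : 0 < q -> 0 < w -> 0 < t ->
  (1 + t)^-1 <= resolvent_sum q w N t.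
Proof.
move=> q0 w0 t0; rewrite /resolvent_sum.
have NN : (N < (N + N).+1)%N by rewrite ltnS leq_addr.
rewrite (bigD1 (Ordinal NN))//= !divff ?gt_eqF ?exprn_gt0// mul1r lerDl.
apply: sumr_ge0 => i _.
by rewrite !(divr_ge0, addr_ge0, exprn_ge0)// ltW.
Qed.

Lemma exprn_arbitrarily_small x y e : 0 <= x < 1 -> 0 <= y < 1 -> 0 < e ->
  exists N, (x ^+ N <= e) && (y ^+ N <= e) :> Prop.
Proof.
move=> x01 y01 e0.
have cv z : 0 <= z < 1 -> ((fun n => z ^+ n) @ \oo --> (0 : R))%classic.
  by move=> /andP[z0 z1]; apply: cvg_expr; rewrite ger0_norm.
have sm z : 0 <= z < 1 -> (\forall n \near \oo, z ^+ n <= e)%classic.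
  move=> z01; have /cvgrPdist_le/(_ _ e0) := cv z z01.
  apply: filterS => n; rewrite sub0r normrN; apply: le_trans; exact: ler_norm.
have [n _ hn] := filterI (sm x x01) (sm y y01).
by exists n; apply/andP; apply: (hn n) => /=.
Qed.

Lemma geometric_cover q m J t : m <= t <= m * q ^+ J.+1 ->
  exists2 j, (j <= J)%N & m * q ^+ j <= t <= m * q ^+ j.+1.
Proof.
elim: J => [|J IH] /andP[mt tq]; first by exists 0%N => //; rewrite expr0 mulr1 mt tq.
have [tJ|tJ] := leP t (m * q ^+ J.+1).
  by have [|j jJ jt] := IH; [rewrite mt tJ|exists j => //; exact: leq_trans jJ _].
by exists J.+1 => //; rewrite (ltW tJ) tq.
Qed.

(** As w/q <= 1, iterating the shift never amplifies earlier errors, and they grow only linearly in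
    [j]. *)
Lemma resolvent_sum_geometric q w m N j : 1 < w -> w < q -> 0 < m ->
  `|resolvent_sum q w N (m * q ^+ j) - (w / q) ^+ j * resolvent_sum q w N m| <=
  j%:R * ((w^-1) ^+ N / m + (w / q) ^+ N).
Proof.
move=> w1 wq m0; have q1 : 1 < q by lra.
have w0 : 0 < w by lra.
have p0 : 0 <= w / q by rewrite divr_ge0; lra.
have p1 : w / q <= 1 by rewrite ler_pdivrMr; lra.
set rho := _ / m + _; have rho0 : 0 <= rho.
  by rewrite /rho addr_ge0 ?divr_ge0 ?exprn_ge0 ?invr_ge0 ?(ltW w0) ?(ltW m0).
elim: j => [|j IH]; first by rewrite !expr0 mulr1 mul1r subrr normr0 mul0r.
have mq : m <= m * q ^+ j by rewrite ler_pMr// exprn_ege1// ltW.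
have -> : m * q ^+ j.+1 = q * (m * q ^+ j) by rewrite exprS mulrCA.
have := resolvent_sum_shift N w1 wq m0 mq; rewrite -/rho.
move: IH; rewrite [(w / q) ^+ j.+1]exprS -[_ * _ ^+ j * _]mulrA.
set A := resolvent_sum _ _ _ (q * _); set B := resolvent_sum _ _ _ (m * _).
set C := _ * resolvent_sum _ _ _ m => IH h.
have -> : A - w / q * C = (A - w / q * B) + w / q * (B - C) by ring.
apply: le_trans (ler_normD _ _) _.
rewrite -natr1 mulrDl mul1r addrC; apply: lerD => //.
rewrite normrM (ger0_norm p0); apply: le_trans IH.
by rewrite ler_piMl.
Qed.

(* [resolvent_sum q (q `^ (s + 1)) N], read with [N] infinite, satisfies the
   functional equation [F (q t) = q `^ s * F t] of [t `^ s].  Being monotone, it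
   agrees with a multiple of [t `^ s] up to a factor between [q^-1] and [q]. *)
Lemma powR_resolvent_approx_interior m M s e :
  0 < m -> m < M -> -1 < s < 0 -> 0 < e ->
  exists n (a l : 'I_n -> R), [/\ (forall i, 0 <= a i), (forall i, 0 <= l i) &
    forall t, m <= t <= M -> `|\sum_i a i / (l i + t) - t `^ s| <= e].
Proof.
move=> m0 mM /andP[s0 s1] e0.
have ms0 : 0 < m `^ s by exact: powR_gt0.
(* On [m, M] the power t^s is at most m^s, so a relative error of q - 1 between neighbouring grid
   points costs at most e/2. *)
have [q q1 qm] : exists2 q, 1 < q & (q - 1) * m `^ s = e / 2.
  exists (1 + e / 2 / m `^ s); first by rewrite ltrDl !divr_gt0.
  by rewrite addrAC subrr add0r divfK// gt_eqF.
have q0 : 0 < q by lra.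
(* Then w/q = q^s, and 1 < w < q because -1 < s < 0. *)
pose w := q `^ (s + 1).
have w1 : 1 < w.
  have : 1 `^ (s + 1) < q `^ (s + 1) by apply: gt0_ltr_powR; rewrite ?nnegrE//; lra.
  by rewrite powR1.
have wqE : w / q = q `^ s.
  by rewrite /w powRD ?(gt_eqF q0) ?implybT// powRr1 ?(ltW q0)// mulfK// gt_eqF.
have qs_lt1 : q `^ s < 1.
  rewrite -[s]opprK powRN invf_lt1 ?powR_gt0//.
  have : 1 `^ (- s) < q `^ (- s) by apply: gt0_ltr_powR; rewrite ?nnegrE//; lra.
  by rewrite powR1.
have wq : w < q by move: qs_lt1; rewrite -wqE ltr_pdivrMr// mul1r.
have qs0 : 0 < q `^ s by exact: powR_gt0.
have qsq : q^-1 <= q `^ s.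
  by rewrite -powR_inv1 ?(ltW q0)// ler_powR// ltW.
have w0 : 0 < w by lra.
have [J MJ] : exists J, M <= m * q ^+ J.+1.
  have [J h1] : exists J, M / m / (q - 1) <= J.+1%:R.
    by exists (Num.truncn (M / m / (q - 1))); apply: ltW; exact: truncnS_gt.
  exists J.
  have h2 : 1 + J.+1%:R * (q - 1) <= q ^+ J.+1.
    rewrite -powR_mulrn ?(ltW q0)//; apply: bernoulli_powR_ge => //.
    by right; rewrite ler1n.
  move: h1; rewrite ler_pdivrMr ?subr_gt0// ler_pdivrMr// => h1.
  apply: le_trans h1 _; rewrite mulrC ler_wpM2l ?(ltW m0)//.
  by apply: le_trans h2; rewrite lerDr.
(* The total amplification of the truncation errors: m^s (1 + m) bounds the normalization [k], at
   most J + 1 shifts occur, and the two errors of a shift add up to a factor 1/m + 1. As [q] and [J]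
   are already fixed, [N] can be chosen against it. *)
pose c := m `^ s * (1 + m) * J.+1%:R * (m^-1 + 1).
have c0 : 0 < c by rewrite !mulr_gt0 ?addr_gt0 ?invr_gt0 ?ltr0n.
have [|||N /andP[Nw Nq]] := @exprn_arbitrarily_small w^-1 (w / q) (e / 2 / c).
- by rewrite invr_ge0 invf_lt1; lra.
- by rewrite wqE qs_lt1 ltW.
- by rewrite !divr_gt0.
have F0 t : 0 < t -> 0 < resolvent_sum q w N t.
  move=> t0; apply: lt_le_trans (resolvent_sum_ge N q0 _ t0); last by lra.
  by rewrite invr_gt0 addr_gt0.
pose k := m `^ s / resolvent_sum q w N m.
have k0 : 0 < k by rewrite divr_gt0 ?F0.
exists (N + N).+1, (fun i => k * (w ^+ i / w ^+ N)), (fun i => q ^+ i / q ^+ N).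
split=> [i|i|t /andP[mt tM]].
- by rewrite mulr_ge0 ?(ltW k0)// divr_ge0 ?exprn_ge0 ?(ltW w0).
- by rewrite divr_ge0 ?exprn_ge0 ?(ltW q0).
have -> : \sum_(i < (N + N).+1) k * (w ^+ i / w ^+ N) / (q ^+ i / q ^+ N + t) =
    k * resolvent_sum q w N t.
  by rewrite /resolvent_sum mulr_sumr; apply: eq_bigr => i _; rewrite -!mulrA.
have grid j : (j <= J.+1)%N ->
    `|k * resolvent_sum q w N (m * q ^+ j) - (m * q ^+ j) `^ s| <= e / 2.
  move=> jJ; rewrite powRM ?exprn_ge0 ?(ltW q0) ?(ltW m0)//.
  have -> : (q ^+ j) `^ s = q `^ s ^+ j.
    by rewrite -(powR_mulrn j (ltW q0)) -(powR_mulrn j (ltW qs0)) powRAC.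
  have -> : k * resolvent_sum q w N (m * q ^+ j) - m `^ s * q `^ s ^+ j =
     k * (resolvent_sum q w N (m * q ^+ j) - (w / q) ^+ j * resolvent_sum q w N m).
    by rewrite -wqE /k; field; rewrite !gt_eqF// F0.
  rewrite normrM (gtr0_norm k0).
  have km : k <= m `^ s * (1 + m).
    rewrite ler_wpM2l ?(ltW ms0)// -[leRHS]invrK lef_pV2 ?posrE ?F0 ?invr_gt0 ?addr_gt0//.
    by apply: resolvent_sum_ge => //; lra.
  have := resolvent_sum_geometric N j w1 wq m0.
  set rho := _ / m + _; set D := `|_| => hD.
  have rho0 : 0 <= rho.
    by rewrite /rho addr_ge0 ?divr_ge0 ?exprn_ge0 ?divr_ge0 ?invr_ge0 ?(ltW w0) ?(ltW q0) ?(ltW m0).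
  have hrho : rho <= e / 2 / c * (m^-1 + 1).
    by rewrite mulrDr mulr1 lerD// ler_wpM2r// invr_ge0 ltW.
  have hD2 : D <= J.+1%:R * (e / 2 / c * (m^-1 + 1)).
    apply: le_trans hD _; apply: ler_pM => //; by rewrite ler_nat.
  apply: (@le_trans _ _ (m `^ s * (1 + m) * (J.+1%:R * (e / 2 / c * (m^-1 + 1))))).
    by apply: ler_pM; rewrite ?(ltW k0) ?normr_ge0.
  have -> : m `^ s * (1 + m) * (J.+1%:R * (e / 2 / c * (m^-1 + 1))) = e / 2 * (c / c).
    by rewrite [in RHS]/c; ring.
  by rewrite divff ?gt_eqF// mulr1.
(* Between grid points both functions decrease, and t^s varies by a factor of at most q, which adds
   the other e/2. *)
have [|j jJ /andP[jt tj]] := @geometric_cover q m J t.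
  by rewrite mt; exact: le_trans MJ.
have := grid j (leqW jJ); have := grid j.+1 jJ.
have mj0 : 0 < m * q ^+ j by rewrite mulr_gt0// exprn_gt0.
have t0 : 0 < t by lra.
have anti1 := resolvent_sum_anti N q0 (lt_trans ltr01 w1) mj0 jt.
have anti2 := resolvent_sum_anti N q0 (lt_trans ltr01 w1) t0 tj.
have pw_anti x y := @le0_ler_powR R s x y (ltW s1).
have b1 := pw_anti _ _ mj0 jt; have b2 := pw_anti _ _ t0 tj.
have b3 := pw_anti _ _ m0 mt.
have e1 : (m * q ^+ j.+1) `^ s = q `^ s * (m * q ^+ j) `^ s.
  by rewrite exprS mulrCA [LHS]powRM ?(ltW q0) ?(ltW mj0).
have {}anti1 := ler_wpM2l (ltW k0) anti1.
have {}anti2 := ler_wpM2l (ltW k0) anti2.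
have t_s0 : 0 < t `^ s by exact: powR_gt0.
have mj_le : (m * q ^+ j) `^ s <= q * t `^ s.
  move: b2; rewrite e1 => b2.
  have h : q^-1 * (m * q ^+ j) `^ s <= t `^ s.
    by apply: le_trans b2; rewrite ler_wpM2r// powR_ge0.
  by move: h; rewrite ler_pdivrMl.
have mj1_ge : t `^ s <= q * (m * q ^+ j.+1) `^ s.
  rewrite e1 mulrA; apply: le_trans b1 _.
  rewrite ler_peMl ?powR_ge0// -ler_pdivrMl ?mulr1//.
have mj1_le : (m * q ^+ j.+1) `^ s <= m `^ s.
  by apply: pw_anti => //; rewrite ler_pMr// exprn_ege1// ltW.
have mq0 := powR_gt0 s (mulr_gt0 m0 (exprn_gt0 j.+1 q0)).
rewrite !ler_norml => /andP[g1 g2] /andP[g3 g4].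
apply/andP; split; nra.
Qed.

Lemma powR_resolvent_approx m M s e :
  0 < m -> m < M -> -1 <= s <= 0 -> 0 < e ->
  exists n (a l : 'I_n -> R), [/\ (forall i, 0 <= a i), (forall i, 0 <= l i) &
    forall t, m <= t <= M -> `|\sum_i a i / (l i + t) - t `^ s| <= e].
Proof.
move=> m0 mM /andP[]; rewrite le_eqVlt => /predU1P[<- _ e0|s0].
  exists 1%N, (fun=> 1), (fun=> 0); split=> // t /andP[mt tM].
  by rewrite big_ord1 add0r div1r powR_inv1 ?subrr ?normr0 ?ltW//; lra.
rewrite le_eqVlt => /predU1P[->|s1] e0; last first.
  by apply: powR_resolvent_approx_interior; rewrite ?s0.
have M0 : 0 < M by lra.
(* The constant 1 is the limit of l/(l + t) as l grows; l = M/e makes the defect t/(l + t) at most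
   [e]. *)
exists 1%N, (fun=> M / e), (fun=> M / e); split=> [i|i|t /andP[mt tM]].
- by rewrite divr_ge0 ?ltW.
- by rewrite divr_ge0 ?ltW.
rewrite big_ord1 powRr0; set l := M / e.
have l0 : 0 < l by rewrite divr_gt0.
have t0 : 0 < t by lra.
have -> : l / (l + t) - 1 = - (t / (l + t)) by field; rewrite gt_eqF ?addr_gt0.
rewrite normrN ger0_norm ?divr_ge0 ?addr_ge0 ?ltW//.
rewrite ltr_pdivrMr ?addr_gt0// mulrDr /l mulrC divfK ?gt_eqF//.
by rewrite -[ltLHS]addr0 ler_ltD// mulr_gt0.
Qed.

End ResolventSums.

(** * Quadratic forms *)

Section RealInnerProduct.
Context (R : realType) (H : hilbertType R).
Implicit Types (x y z : H) (c : R).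

(** Forms of self-adjoint operators are real, so taking real parts moves all order arguments from
    the partially ordered R[i] to R. *)
Definition rdot x y : R := complex.Re (hdot x y).
Definition rnorm x : R := complex.Re `|x|.

Lemma ReD (a b : R[i]) : complex.Re (a + b) = complex.Re a + complex.Re b.
Proof. by case: a; case: b. Qed.

Lemma ReZ c (a : R[i]) : complex.Re (c%:C * a) = c * complex.Re a.
Proof. by case: a => u v /=; rewrite mul0r subr0. Qed.

Lemma Re_conj (a : R[i]) : complex.Re a^* = complex.Re a.
Proof. by case: a. Qed.

Lemma conj_real c : (c%:C^* = c%:C :> R[i])%C.
Proof. exact: conjc_real. Qed.

Lemma rdotDl x y z : rdot (x + y) z = rdot x z + rdot y z.
Proof. by rewrite /rdot linearDl ReD. Qed.

Lemma rdotZl c x y : rdot (c%:C *: x) y = c * rdot x y.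
Proof. by rewrite /rdot linearZl_LR ReZ. Qed.

Lemma rdotC x y : rdot x y = rdot y x.
Proof. by rewrite /rdot hermC /= expr0 mul1r Re_conj. Qed.

Lemma rdotDr x y z : rdot x (y + z) = rdot x y + rdot x z.
Proof. by rewrite rdotC rdotDl !(rdotC x). Qed.

Lemma rdotZr c x y : rdot x (c%:C *: y) = c * rdot x y.
Proof. by rewrite rdotC rdotZl rdotC. Qed.

Lemma rdotNl x y : rdot (- x) y = - rdot x y.
Proof.
have -> : - x = (-1)%:C *: x by rewrite rmorphN1 scaleN1r.
by rewrite rdotZl mulN1r.
Qed.

Lemma rdotNr x y : rdot x (- y) = - rdot x y.
Proof. by rewrite rdotC rdotNl rdotC. Qed.

Lemma rdotBl x y z : rdot (x - y) z = rdot x z - rdot y z.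
Proof. by rewrite rdotDl rdotNl. Qed.

Lemma rdotBr x y z : rdot x (y - z) = rdot x y - rdot x z.
Proof. by rewrite rdotDr rdotNr. Qed.

Lemma rdot0l x : rdot 0 x = 0.
Proof. by rewrite -(subrr x) rdotBl subrr. Qed.

Lemma rdot_suml n (f : 'I_n -> H) y :
  rdot (\sum_i f i) y = \sum_i rdot (f i) y.
Proof.
by elim/big_rec2: _ => [|i a b _ <-]; rewrite ?rdot0l ?rdotDl.
Qed.

Lemma normE x : `|x| = (rnorm x)%:C.
Proof. by rewrite /rnorm RRe_real// normr_real. Qed.

Lemma rnorm_ge0 x : 0 <= rnorm x.
Proof. by rewrite -lecR -normE normr_ge0. Qed.

Lemma rdotxx x : rdot x x = rnorm x ^+ 2.
Proof. by rewrite /rdot hdot_norm normE -rmorphXn. Qed.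

Lemma rnormD x y : rnorm (x + y) <= rnorm x + rnorm y.
Proof. by rewrite -lecR rmorphD /= -!normE ler_normD. Qed.

Lemma rnormN x : rnorm (- x) = rnorm x.
Proof. by rewrite /rnorm normrN. Qed.

Lemma rnorm0 : rnorm 0 = 0.
Proof. by rewrite /rnorm normr0. Qed.

Lemma rnorm_eq0 x : rnorm x = 0 -> x = 0.
Proof. by move=> x0; apply/eqP; rewrite -normr_eq0 normE x0. Qed.

(** The squared norm of |y| x - |x| y equals 2 |x| |y| (|x| |y| - <x, y>). *)
Lemma rdot_le x y : rdot x y <= rnorm x * rnorm y.
Proof.
have [x0|x0] := eqVneq (rnorm x) 0.
  by rewrite (rnorm_eq0 x0) rdot0l rnorm0 mul0r.
have [y0|y0] := eqVneq (rnorm y) 0.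
  by rewrite (rnorm_eq0 y0) rdotC rdot0l rnorm0 mulr0.
have xy : 0 < rnorm x * rnorm y by rewrite mulr_gt0// lt_def ?x0 ?y0 rnorm_ge0.
have := sqr_ge0 (rnorm ((rnorm y)%:C *: x - (rnorm x)%:C *: y)).
rewrite -rdotxx !(rdotBl, rdotBr, rdotZl, rdotZr) !rdotxx (rdotC y x).
move=> h; rewrite -subr_ge0 -(pmulr_rge0 _ (mulr_gt0 (ltr0Sn R 1) xy)).
by apply: le_trans h _; rewrite le_eqVlt; apply/orP; left; apply/eqP; ring.
Qed.

Lemma rdot_norm_le x y : `|rdot x y| <= rnorm x * rnorm y.
Proof.
rewrite ler_norml rdot_le andbT lerNl -rdotNl.
by apply: le_trans (rdot_le _ _) _; rewrite rnormN.
Qed.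

End RealInnerProduct.

Section QuadraticForms.
Context (R : realType) (H : hilbertType R).
Implicit Types (x y : H) (c : R) (A B : bop H).

Definition qform A x : R := rdot (A x) x.

Lemma bopBE A B x : (A - B) x = A x - B x. Proof. by []. Qed.

Lemma bop_sumE n (F : 'I_n -> bop H) x : (\sum_i F i) x = \sum_i F i x.
Proof. by elim/big_rec2: _ => [//|i a b _ <-]. Qed.

Lemma bopZr c A x : A (c%:C *: x) = c%:C *: A x.
Proof. exact: linearZ. Qed.

Lemma bopDr A x y : A (x + y) = A x + A y.
Proof. exact: linearD. Qed.

Lemma bopBr A x y : A (x - y) = A x - A y.
Proof. exact: linearB. Qed.

Lemma bop_scalarE (c : R) x : (scalar_op c%:C : bop H) x = c%:C *: x.
Proof. by []. Qed.

Lemma bopZlM (k : R[i]) A B : (k *: A) * B = k *: (A * B).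
Proof. exact: bop_ext. Qed.

Lemma bopZrM (k : R[i]) A B : A * (k *: B) = k *: (A * B).
Proof. by apply: bop_ext => x; exact: linearZ. Qed.

Lemma bop_bound A : exists2 c, 0 < c & forall x, rnorm (A x) <= c * rnorm x.
Proof.
have [c hc] := bop_bounded A; exists (`|c| + 1) => [|x].
  by rewrite ltr_wpDl.
have := hc x; rewrite !normE -rmorphM /= lecR => /le_trans; apply.
by apply: ler_wpM2r; [exact: rnorm_ge0|rewrite ler_wpDr// ler_norm].
Qed.

Lemma qformD A B x : qform (A + B) x = qform A x + qform B x.
Proof. exact: rdotDl. Qed.

Lemma qformB A B x : qform (A - B) x = qform A x - qform B x.
Proof. exact: rdotBl. Qed.

Lemma qformN A x : qform (- A) x = - qform A x.
Proof. exact: rdotNl. Qed.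

Lemma qformZ c A x : qform (c%:C *: A) x = c * qform A x.
Proof. exact: rdotZl. Qed.

Lemma qform1 x : qform 1 x = rnorm x ^+ 2.
Proof. exact: rdotxx. Qed.

Lemma qform_scalar c x : qform (scalar_op c%:C) x = c * rnorm x ^+ 2.
Proof. by rewrite qformZ qform1. Qed.

Lemma qform_sum n (F : 'I_n -> bop H) x : qform (\sum_i F i) x = \sum_i qform (F i) x.
Proof. by rewrite /qform bop_sumE rdot_suml. Qed.

Lemma selfadjoint_rdot A x y : selfadjoint A -> rdot (A x) y = rdot x (A y).
Proof. by move=> sA; rewrite /rdot sA. Qed.

Lemma selfadjoint1 : selfadjoint (1 : bop H).
Proof. by []. Qed.

Lemma selfadjointD A B : selfadjoint A -> selfadjoint B -> selfadjoint (A + B).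
Proof. by move=> sA sB x y; rewrite !bopDE linearDl linearDr /= sA sB. Qed.

Lemma selfadjointZ c A : selfadjoint A -> selfadjoint (c%:C *: A).
Proof.
move=> sA x y; rewrite !bopZE linearZl_LR linearZr_LR /= sA; congr (_ * _).
by rewrite [RHS]conj_real.
Qed.

Lemma selfadjointB A B : selfadjoint A -> selfadjoint B -> selfadjoint (A - B).
Proof. by move=> sA sB x y; rewrite !bopBE linearBl linearBr /= sA sB. Qed.

Lemma selfadjoint_scalar c : selfadjoint (scalar_op c%:C : bop H).
Proof. exact/selfadjointZ/selfadjoint1. Qed.

Lemma selfadjoint_sum n (F : 'I_n -> bop H) :
  (forall i, selfadjoint (F i)) -> selfadjoint (\sum_i F i).
Proof.
move=> sF; elim/big_ind: _ => // [x y|A B]; last exact: selfadjointD.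
by rewrite linear0l linear0r.
Qed.

Lemma selfadjointX A n : selfadjoint A -> selfadjoint (A ^+ n).
Proof.
move=> sA; elim: n => [|n IH] x y //; rewrite {1}exprS exprSr !bopME.
by rewrite sA IH.
Qed.

Lemma selfadjoint_Im A x : selfadjoint A -> complex.Im (hdot (A x) x) = 0.
Proof.
move=> sA; have : hdot (A x) x = (hdot (A x) x)^*%C.
  by rewrite {1}sA hermC expr0 mul1r.
by move=> /(congr1 (@complex.Im R)); case: (hdot _ _) => a b /= ?; lra.
Qed.

Lemma positive_opP A : selfadjoint A -> (forall x, 0 <= qform A x) -> positive_op A.
Proof.
by move=> sA A0; split=> // x; rewrite lecE/= (selfadjoint_Im _ sA) eqxx; exact: A0.
Qed.

Lemma positive_op_qform A x : positive_op A -> 0 <= qform A x.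
Proof. by case=> _ /(_ x); rewrite lecE => /andP[]. Qed.

(** Every operator inequality of the theorem is reduced by this to a scalar one, vector by
    vector. *)
Lemma loewnerP A B : selfadjoint A -> selfadjoint B ->
  (forall x, qform A x <= qform B x) -> (A <=L B)%loewner.
Proof.
move=> sA sB AB; split=> //; apply: positive_opP; first exact: selfadjointB.
by move=> x; rewrite qformB subr_ge0.
Qed.

(* The optimal [s] in [0 <= qform S (x - s *: S x)] is of order [1 / |S|]. *)
Lemma qform_ge_norm S c x : selfadjoint S -> (forall y, 0 <= qform S y) -> 0 < c ->
  (forall y, rnorm (S y) <= c * rnorm y) -> rnorm (S x) ^+ 2 <= c * qform S x.
Proof.
move=> sS S0 c0 Sc.
have := S0 (x - c^-1%:C *: S x).
rewrite /qform bopBr bopZr !(rdotBl, rdotBr, rdotZl, rdotZr) -/(qform S x).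
rewrite (selfadjoint_rdot (S x) x sS) !rdotxx => h.
have := le_trans (rdot_le (S (S x)) (S x)) (ler_wpM2r (rnorm_ge0 _) (Sc (S x))).
rewrite -mulrA -expr2.
move: h; set n := rnorm _ ^+ 2; set d := rdot (S (S x)) _ => h hd.
have {}h : 0 <= qform S x - c^-1 * n.
  apply: le_trans h _; rewrite -subr_ge0.
  rewrite (_ : _ - _ = c^-1 * c^-1 * (c * n - d)); last by field; rewrite gt_eqF.
  by rewrite mulr_ge0 ?mulr_ge0 ?invr_ge0 ?(ltW c0)// subr_ge0.
by move: h; rewrite subr_ge0 ler_pdivrMl.
Qed.

(* Polarization, with [y] a multiple of [T x]. *)
Lemma norm_le_qform T e : selfadjoint T -> 0 < e ->
  (forall x, `|qform T x| <= e * rnorm x ^+ 2) ->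
  forall x, rnorm (T x) <= e * rnorm x.
Proof.
move=> sT e0 Te x.
have h1 := le_trans (ler_norm _) (Te (x + e^-1%:C *: T x)).
have : - qform T (x - e^-1%:C *: T x) <= e * rnorm (x - e^-1%:C *: T x) ^+ 2.
  by apply: le_trans (Te _); rewrite -normrN ler_norm.
move: h1.
rewrite /qform bopDr bopBr bopZr -!rdotxx.
rewrite !(rdotDl, rdotDr, rdotNl, rdotNr, rdotZl, rdotZr).
rewrite (rdotC (T (T x)) x) -(selfadjoint_rdot x (T x) sT) (rdotC x (T x)) !rdotxx.
set n := rnorm (T x); set d := rdot (T (T x)) _; set a := rdot (T x) x => h1 h2.
have hn : n ^+ 2 <= (e * rnorm x) ^+ 2.
  have i2 : 0 < e^-1 by rewrite invr_gt0.
  have ee : e * e^-1 = 1 by rewrite divff ?gt_eqF.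
  have h : 2 * e^-1 * n ^+ 2 <= e * rnorm x ^+ 2 + e^-1 * n ^+ 2.
    have -> : e^-1 * n ^+ 2 = e * e^-1 * e^-1 * n ^+ 2 by rewrite ee mul1r.
    by lra.
  have {}h : e^-1 * n ^+ 2 <= e * rnorm x ^+ 2 by lra.
  move: h; rewrite ler_pdivrMl// => /le_trans; apply.
  by rewrite exprMn mulrA -expr2.
by rewrite -(ler_pXn2r (n := 2)) ?nnegrE ?mulr_ge0 ?rnorm_ge0// ltW.
Qed.

End QuadraticForms.

(** * Complete spaces of operators *)

Section Completeness.
Context (R : realType) (H : hilbertType R).
Implicit Types (x y : H) (e : nat -> R).

Lemma rnormZC (k : R[i]) x : rnorm (k *: x) = complex.Re `|k| * rnorm x.
Proof.
by apply: complexI; rewrite rmorphM /= -!normE normrZ; congr (_ * _).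
Qed.

(** One index per tolerance is enough, because the Cauchy estimates below bound all differences
    after index [n] by [e n]. *)
Definition vanishing e := forall d : R, 0 < d -> exists n, e n <= d.

Lemma vanishing_le0 e (a c : R) : vanishing e -> 0 <= c ->
  (forall n, a <= e n * c) -> a <= 0.
Proof.
move=> e0 c0 h; apply/ler_addgt0Pr => d d0; rewrite add0r.
have c1 : 0 < c + 1 by lra.
have [n hn] := e0 _ (divr_gt0 d0 c1).
apply: le_trans (h n) _; apply: le_trans (ler_wpM2r c0 hn) _.
by rewrite mulrAC ler_pdivrMr// ler_wpM2l ?(ltW d0)//; lra.
Qed.

Lemma hilbert_cauchy (v : nat -> H) e : vanishing e ->
  (forall n k, rnorm (v (n + k)%N - v n) <= e n) ->
  exists l, forall n, rnorm (v n - l) <= e n.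
Proof.
move=> e0 ve.
have cv : cvgn v.
  apply/cauchy_cvgP; apply: cauchy_exP => eps eps0.
  have [d deps] : exists d : R, eps = d%:C.
    by exists (complex.Re eps); rewrite RRe_real// gtr0_real.
  have d0 : 0 < d by rewrite -ltcR -deps.
  have [n hn] := e0 (d / 2) ltac:(lra).
  exists (v n); exists n => // k /= nk; rewrite -ball_normE /= deps normE ltcR.
  rewrite -(subnKC nk) -rnormN opprB.
  by apply: le_lt_trans (ve _ _) _; lra.
exists (limn v) => n; apply/ler_addgt0Pr => d d0.
have /cvgrPdist_le/(_ d%:C) := cv; rewrite ltcR => /(_ d0)[N _ hN].
have /hN : (N <= n + N)%N by rewrite leq_addl.
rewrite /= normE lecR -rnormN opprB => h.
have -> : v n - limn v = - (v (n + N)%N - v n) + (v (n + N)%N - limn v).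
  by rewrite opprB addrA subrK.
by apply: le_trans (rnormD _ _) _; rewrite rnormN lerD.
Qed.

(** The limit is taken pointwise. Its defect of linearity is bounded by a multiple of [e n] for
    every [n], and comparison with [u 0] bounds it. *)
Lemma bop_complete (u : nat -> bop H) e : vanishing e ->
  (forall n k x, rnorm ((u (n + k)%N - u n) x) <= e n * rnorm x) ->
  exists B : bop H, forall n x, rnorm ((u n - B) x) <= e n * rnorm x.
Proof.
move=> e0 ue.
have lim x : exists l, forall n, rnorm (u n x - l) <= e n * rnorm x.
  apply: hilbert_cauchy => [d d0|n k]; last exact: ue.
  have x1 : 0 < rnorm x + 1 by have := rnorm_ge0 x; lra.
  have [n hn] := e0 _ (divr_gt0 d0 x1); exists n.
  apply: le_trans (ler_wpM2r (rnorm_ge0 x) hn) _.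
  by rewrite mulrAC ler_pdivrMr// ler_wpM2l ?(ltW d0)//; lra.
pose f x := projT1 (cid (lim x)).
have fE n x : rnorm (u n x - f x) <= e n * rnorm x by rewrite /f; case: cid.
have fB : f \in @bounded_op R H.
  apply/asboolP; split=> [k x y|].
    apply/eqP; rewrite -subr_eq0; apply/eqP/rnorm_eq0/le_anti.
    rewrite rnorm_ge0 andbT.
    have C0 : 0 <= rnorm (k *: x + y) + (complex.Re `|k| * rnorm x + rnorm y).
      by rewrite -rnormZC !addr_ge0 ?rnorm_ge0.
    apply: (vanishing_le0 e0 C0) => n.
    have -> : f (k *: x + y) - (k *: f x + f y) =
        - (u n (k *: x + y) - f (k *: x + y)) + (k *: (u n x - f x) + (u n y - f y)).
      rewrite (bop_linear (u n)) scalerBr [X in _ = _ + X]addrACA -opprD.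
      by rewrite opprB addrA subrK.
    apply: le_trans (rnormD _ _) _; rewrite rnormN mulrDr lerD//.
    apply: le_trans (rnormD _ _) _; rewrite rnormZC mulrDr lerD//.
    rewrite mulrCA ler_wpM2l//.
    by rewrite -(ler0c (complex.Re `|k|)) RRe_real ?normr_real// normr_ge0.
  have [c c0 hc] := bop_bound (u 0%N).
  exists (c + e 0%N) => x; rewrite !normE -rmorphM /= lecR.
  have -> : f x = u 0%N x - (u 0%N x - f x) by rewrite opprB addrC subrK.
  by apply: le_trans (rnormD _ _) _; rewrite rnormN mulrDl lerD.
by exists (Bop fB) => n x; exact: fE.
Qed.

Lemma bop_expr_norm (U : bop H) (r : R) n x : 0 <= r ->
  (forall y, rnorm (U y) <= r * rnorm y) -> rnorm ((U ^+ n) x) <= r ^+ n * rnorm x.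
Proof.
move=> r0 Ur; elim: n => [|n IH]; first by rewrite expr0 mul1r.
rewrite exprS bopME; apply: le_trans (Ur _) _.
by rewrite exprS -mulrA ler_wpM2l.
Qed.

Lemma neumann_series (U : bop H) (r : R) : 0 <= r < 1 ->
  (forall x, rnorm (U x) <= r * rnorm x) -> invertible_op (1 - U).
Proof.
move=> r01 Ur; have /andP[r0 r1] := r01.
pose u n := \sum_(i < n) U ^+ i; pose e n := r ^+ n / (1 - r).
have r1' : 0 < 1 - r by lra.
have e0 : vanishing e.
  move=> d d0; have [|n /andP[hn _]] := exprn_arbitrarily_small r01 r01 (e := d * (1 - r)).
    by rewrite mulr_gt0.
  by exists n; rewrite /e ler_pdivrMr.
have uS n : u n.+1 = u n + U ^+ n by rewrite /u big_ord_recr.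
have ue n k x : rnorm ((u (n + k)%N - u n) x) <= e n * rnorm x.
  apply: (@le_trans _ _ ((r ^+ n - r ^+ (n + k)) / (1 - r) * rnorm x)); last first.
    rewrite ler_wpM2r ?rnorm_ge0// ler_wpM2r ?invr_ge0 ?(ltW r1')//.
    by rewrite gerBl exprn_ge0.
  elim: k => [|k IH].
    by rewrite addn0 !subrr !mul0r [X in rnorm X]/(0 : H) rnorm0.
  rewrite addnS uS addrAC bopDE; apply: le_trans (rnormD _ _) _.
  have -> : (r ^+ n - r ^+ (n + k).+1) / (1 - r) * rnorm x =
    (r ^+ n - r ^+ (n + k)) / (1 - r) * rnorm x + r ^+ (n + k) * rnorm x.
    by rewrite exprS; field; lra.
  by apply: lerD => //; exact: bop_expr_norm.
have [B hB] := bop_complete e0 ue.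
have uL n : (1 - U) * u n = 1 - U ^+ n.
  elim: n => [|n IH]; first by rewrite /u big_ord0 mulr0 expr0 subrr.
  by rewrite uS mulrDr IH mulrBl mul1r -exprS addrA subrK.
have uR n : u n * (1 - U) = 1 - U ^+ n.
  elim: n => [|n IH]; first by rewrite /u big_ord0 mul0r expr0 subrr.
  by rewrite uS mulrDl IH mulrBr mulr1 -exprSr addrA subrK.
(* The same rate controls the telescoping defect U^n and the distance from the partial sums to [B],
   so both vanish together. *)
have Un n x : rnorm ((U ^+ n) x) <= e n * rnorm x.
  apply: le_trans (bop_expr_norm _ _ r0 Ur) _.
  rewrite ler_wpM2r ?rnorm_ge0// /e ler_pdivlMr// ler_piMr ?exprn_ge0//; lra.
have zero x y : (exists2 c, 0 <= c & forall n, rnorm (x - y) <= e n * c) -> x = y.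
  move=> [c c0 hc]; apply/eqP; rewrite -subr_eq0; apply/eqP/rnorm_eq0/le_anti.
  by rewrite rnorm_ge0 andbT (vanishing_le0 e0 c0).
have cancel (a c y : H) : a + (c - y) - c = a - y.
  by rewrite [c - y]addrC addrA addrK.
exists B; split; apply: bop_ext => x; apply: zero.
- exists ((rnorm x + r * rnorm x) + rnorm x) => [|n].
    by rewrite !addr_ge0 ?mulr_ge0 ?rnorm_ge0.
  have -> : ((1 - U) * B) x - (1 : bop H) x = - ((1 - U) ((u n - B) x)) - (U ^+ n) x.
    have e1 : (1 - U) (u n x) = x - (U ^+ n) x.
      by have := congr1 (fun V : bop H => V x) (uL n).
    by rewrite [(u n - B) x]bopBE bopBr e1 opprB opprB cancel.
  apply: le_trans (rnormD _ _) _; rewrite !rnormN mulrDr lerD//.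
  rewrite bopBE bop1E; apply: le_trans (rnormD _ _) _; rewrite rnormN mulrDr lerD//.
  by rewrite mulrCA; apply: le_trans (Ur _) _; rewrite ler_wpM2l.
- exists (rnorm ((1 - U) x) + rnorm x) => [|n].
    by rewrite addr_ge0 ?rnorm_ge0.
  have -> : (B * (1 - U)) x - (1 : bop H) x = - ((u n - B) ((1 - U) x)) - (U ^+ n) x.
    have e1 : u n ((1 - U) x) = x - (U ^+ n) x.
      by have := congr1 (fun V : bop H => V x) (uR n).
    by rewrite [(u n - B) _]bopBE e1 opprB opprB cancel.
  by apply: le_trans (rnormD _ _) _; rewrite !rnormN mulrDr lerD.
Qed.

End Completeness.

(** * Spectrum and numerical range *)

Section SpectrumBounds.
Context (R : realType) (H : hilbertType R).
Implicit Types (x y : H) (A B T S : bop H) (c m M : R).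

Lemma invertible_opM A B : invertible_op A -> invertible_op B -> invertible_op (A * B).
Proof.
move=> [A' [AA' A'A]] [B' [BB' B'B]]; exists (B' * A'); split.
  by rewrite mulrA -(mulrA A) BB' mulr1.
by rewrite mulrA -(mulrA B') A'A mulr1.
Qed.

(** The inverse [C] of the product commutes with [B], which makes B C a two-sided inverse of [A]. *)
Lemma invertible_op_factor A B : A * B = B * A -> invertible_op (A * B) ->
  invertible_op A.
Proof.
move=> AB [C [ABC CAB]]; exists (B * C); split; first by rewrite mulrA.
have BS : B * (A * B) = A * B * B by rewrite mulrA -AB.
suff -> : B * C = C * B by rewrite -mulrA -AB.
transitivity (C * (A * B * B) * C); first by rewrite -[LHS]mul1r -CAB !mulrA.
by rewrite -BS -mulrA -[X in C * X]mulrA ABC mulr1.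
Qed.

Lemma invertible_opZ (k : R[i]) A : k != 0 -> invertible_op A -> invertible_op (k *: A).
Proof.
move=> k0 [B [AB BA]]; exists (k^-1 *: B).
by rewrite !bopZlM !bopZrM !scalerA AB BA divff// mulVf// scale1r.
Qed.

(** For C = b + c with [b] a norm bound of [T], the form of U = 1 - T/C lies between 0 and 1 - c/C <
    1, so [U] is a strict contraction and T = C (1 - U) is inverted by a Neumann series. *)
Lemma invertible_bounded_below T c : selfadjoint T -> 0 < c ->
  (forall x, c * rnorm x ^+ 2 <= qform T x) -> invertible_op T.
Proof.
move=> sT c0 Tc; have [b b0 hb] := bop_bound T.
pose C := b + c; have C0 : 0 < C by rewrite /C; lra.
pose r := 1 - C^-1 * c.
have cC : C^-1 * c < 1 by rewrite ltr_pdivrMl// mulr1 /C; lra.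
have cC0 : 0 < C^-1 * c by rewrite mulr_gt0 ?invr_gt0.
pose U : bop H := 1 - C^-1%:C *: T.
have sU : selfadjoint U.
  by apply: selfadjointB; [exact: selfadjoint1|exact: selfadjointZ].
have UE x : qform U x = rnorm x ^+ 2 - C^-1 * qform T x.
  by rewrite qformB qformZ qform1.
have Ur x : rnorm (U x) <= r * rnorm x.
  apply: norm_le_qform => //; first by rewrite subr_gt0.
  move=> y; have n0 : 0 <= rnorm y ^+ 2 by exact: sqr_ge0.
  have h1 : C^-1 * (c * rnorm y ^+ 2) <= C^-1 * qform T y.
    by rewrite ler_wpM2l ?invr_ge0 ?(ltW C0).
  have h2 : C^-1 * qform T y <= rnorm y ^+ 2.
    rewrite ler_pdivrMl//; apply: le_trans (rdot_le _ _) _.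
    apply: le_trans (ler_wpM2r (rnorm_ge0 y) (hb y)) _.
    by rewrite -mulrA -expr2 ler_wpM2r// /C; lra.
  rewrite UE ger0_norm ?subr_ge0// /r mulrBl mul1r lerD2l lerN2.
  by rewrite -mulrA.
have [B [UB BU]] : invertible_op (1 - U).
  by apply: neumann_series Ur; rewrite /r; lra.
have -> : T = C%:C *: (1 - U).
  by rewrite /U subKr scalerA -rmorphM divff ?gt_eqF// scale1r.
apply: invertible_opZ; last by exists B.
by rewrite fmorph_eq0 gt_eqF.
Qed.

Lemma scalar_opC T (z : R[i]) : scalar_op z * T = T * scalar_op z.
Proof. by rewrite /scalar_op bopZlM bopZrM mul1r mulr1. Qed.

(** For z = a + ib with b nonzero, (T - z)(T - a + ib) = (T - a)^2 + b^2 is bounded below by b^2.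
    For real z outside [m, M], T - z or z - T is bounded below. *)
Lemma spectrum_bounds T m M : selfadjoint T ->
  (forall x, m * rnorm x ^+ 2 <= qform T x) ->
  (forall x, qform T x <= M * rnorm x ^+ 2) ->
  forall z : R[i], spectrum T z -> m%:C <= z <= M%:C.
Proof.
move=> sT Tm TM z Tz.
have sTc c : selfadjoint (T - scalar_op c%:C).
  by apply: selfadjointB => //; exact: selfadjoint_scalar.
have qTc c x : qform (T - scalar_op c%:C) x = qform T x - c * rnorm x ^+ 2.
  by rewrite qformB qform_scalar.
have [Imz|Imz] := eqVneq (complex.Im z) 0; last first.
  case: Tz; case: z Imz => a b /= b0.
  pose S := T - scalar_op a%:C; pose k : bop H := scalar_op (0 +i* b).
  have zE : scalar_op (a +i* b) = scalar_op a%:C + k.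
    by rewrite /k /scalar_op -scalerDl; congr (_ *: _); simpc.
  have SE : T - scalar_op (a +i* b) = S - k by rewrite zE opprD addrA.
  have kk : k * k = - scalar_op (b ^+ 2)%:C.
    rewrite /k /scalar_op bopZlM bopZrM mul1r scalerA -scaleNr.
    by congr (_ *: _); simpc; rewrite expr2.
  have SkC : k * S = S * k by exact: scalar_opC.
  have SS : (S - k) * (S + k) = S ^+ 2 + scalar_op (b ^+ 2)%:C.
    by rewrite mulrDr [(S - k) * S]mulrBl [(S - k) * k]mulrBl
      SkC kk opprK [S ^+ 2]expr2 [LHS]addrA subrK.
  rewrite SE; apply: (@invertible_op_factor _ (S + k)).
    rewrite [LHS]mulrDr [RHS]mulrDl [(S - k) * S]mulrBl [(S - k) * k]mulrBl.
    by rewrite [S * (S - k)]mulrBr [k * (S - k)]mulrBr SkC.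
  rewrite SS; apply: (@invertible_bounded_below _ (b ^+ 2)).
  - by apply: selfadjointD; [exact/selfadjointX/sTc|exact: selfadjoint_scalar].
  - by rewrite lt_def sqrf_eq0 b0 sqr_ge0.
  move=> x; rewrite qformD qform_scalar lerDr /qform expr2 bopME.
  by rewrite (selfadjoint_rdot _ _ (sTc a)) rdotxx sqr_ge0.
move: (Imz); case: z Imz Tz => a b /= -> Tz _.
rewrite !lecE /= eqxx /= andbC; apply/andP; split; rewrite leNgt; apply/negP => h;
  apply: Tz.
- have -> : T - scalar_op (a +i* 0) = (-1) *: (scalar_op a%:C - T).
    by rewrite scaleN1r opprB.
  apply: invertible_opZ; first by rewrite oppr_eq0 oner_eq0.
  apply: (@invertible_bounded_below _ (a - M)); rewrite ?subr_gt0//.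
    by apply: selfadjointB => //; exact: selfadjoint_scalar.
  by move=> x; rewrite qformB qform_scalar mulrBl lerD2l lerN2.
- apply: (@invertible_bounded_below (T - scalar_op a%:C) (m - a)); rewrite ?subr_gt0//.
  by move=> x; rewrite qTc mulrBl lerD2r.
Qed.

(** A bounded inverse gives |x| <= b |S x|, and [qform_ge_norm] turns |S x|^2 into the form of
    [S]. *)
Lemma invertible_qform_gt S : selfadjoint S -> (forall x, 0 <= qform S x) ->
  invertible_op S -> exists2 d, 0 < d & forall x, d * rnorm x ^+ 2 <= qform S x.
Proof.
move=> sS S0 [B [_ BS]].
have [b b0 hb] := bop_bound B; have [c c0 hc] := bop_bound S.
exists (b ^+ 2 * c)^-1 => [|x]; first by rewrite invr_gt0 mulr_gt0 ?exprn_gt0.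
rewrite ler_pdivrMl ?mulr_gt0 ?exprn_gt0//.
have hx : rnorm x <= b * rnorm (S x) by have := hb (S x); rewrite -bopME BS.
apply: (@le_trans _ _ ((b * rnorm (S x)) ^+ 2)).
  by rewrite ler_sqr ?nnegrE ?mulr_ge0 ?rnorm_ge0 ?(ltW b0).
rewrite exprMn -[leRHS]mulrA ler_wpM2l ?sqr_ge0//.
exact: qform_ge_norm.
Qed.

(* The infimum of the numerical range of [T] lies in the spectrum of [T]. *)
Lemma qform_ge0_spectrum T : selfadjoint T ->
  (forall t : R, t < 0 -> invertible_op (T - scalar_op t%:C)) ->
  forall x, 0 <= qform T x.
Proof.
move=> sT invT x0; rewrite leNgt; apply/negP => q0.
have n0 : 0 < rnorm x0 ^+ 2.
  rewrite exprn_gt0// lt_def rnorm_ge0 andbT; apply: contraTN q0 => /eqP/rnorm_eq0->.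
  by rewrite /qform rdotC rdot0l ltxx.
pose E := [set t : R | forall x, t * rnorm x ^+ 2 <= qform T x]%classic.
have ubE x : 0 < rnorm x ^+ 2 -> ubound E (qform T x / rnorm x ^+ 2).
  by move=> x1 t /(_ x); rewrite ler_pdivlMr.
have E0 : (E !=set0)%classic.
  have [c c0 hc] := bop_bound T; exists (- c) => x /=.
  rewrite mulNr lerNl /qform -rdotNl; apply: le_trans (rdot_le _ _) _.
  by rewrite rnormN expr2 mulrA ler_wpM2r ?rnorm_ge0.
have supE : has_sup E by split=> //; exists (qform T x0 / rnorm x0 ^+ 2); exact: ubE.
pose mu := sup E.
have mu0 : mu < 0.
  apply: (@le_lt_trans _ _ (qform T x0 / rnorm x0 ^+ 2)).
    by apply: ge_sup => //; exact: ubE.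
  by rewrite ltr_pdivrMr// mul0r.
have Emu x : mu * rnorm x ^+ 2 <= qform T x.
  have [x1|x1] := eqVneq (rnorm x) 0.
    by rewrite x1 (rnorm_eq0 x1) expr0n mulr0 /qform rdotC rdot0l.
  have x2 : 0 < rnorm x ^+ 2 by rewrite exprn_gt0// lt_def x1 rnorm_ge0.
  by rewrite -ler_pdivlMr//; apply: ge_sup => //; exact: ubE.
have sTm : selfadjoint (T - scalar_op mu%:C).
  by apply: selfadjointB => //; exact: selfadjoint_scalar.
have qTm x : qform (T - scalar_op mu%:C) x = qform T x - mu * rnorm x ^+ 2.
  by rewrite qformB qform_scalar.
(* T - mu is positive and, as mu < 0, invertible; hence its form has a margin [d], and mu + d
   contradicts the supremum. *)
have [|d d0 hd] := invertible_qform_gt sTm _ (invT _ mu0).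
  by move=> x; rewrite qTm subr_ge0.
have : E (mu + d) by move=> x /=; rewrite mulrDl -lerBrDl -qTm.
by move=> /(sup_upper_bound supE); rewrite -/mu gerDl leNgt d0.
Qed.

End SpectrumBounds.

(** * Polynomial and continuous functional calculus *)

Section PolynomialCalculus.
Context (R : realType) (H : hilbertType R).
Implicit Types (x y : H) (A B T : bop H) (p q : {poly R}).

Section Complex.
Implicit Types (P Q : {poly R[i]}).

(** Complex coefficients allow a factorization into linear factors, also for real polynomials
    without real roots. *)
Definition cpoly_op P A : bop H := \sum_(i < size P) P`_i *: A ^+ i.

Lemma cpoly_op_wide n P A : (size P <= n)%N ->
  cpoly_op P A = \sum_(i < n) P`_i *: A ^+ i.
Proof.
move=> Pn; rewrite /cpoly_op (big_ord_widen n (fun i => P`_i *: A ^+ i) Pn).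
rewrite big_mkcond /=; apply: eq_bigr => i _; case: ltnP => // Pi.
by rewrite nth_default// scale0r.
Qed.

Lemma cpoly_opP (k : R[i]) P Q A :
  cpoly_op (k *: P + Q) A = k *: cpoly_op P A + cpoly_op Q A.
Proof.
pose n := maxn (size P) (size Q).
have kPQ : (size (k *: P + Q)%R <= n)%N.
  apply: leq_trans (size_polyD _ _) _; rewrite geq_max leq_maxr andbT.
  exact: leq_trans (size_scale_leq _ _) (leq_maxl _ _).
rewrite !(@cpoly_op_wide n) ?leq_maxl ?leq_maxr// scaler_sumr -big_split /=.
by apply: eq_bigr => i _; rewrite coefD coefZ scalerDl scalerA.
Qed.

Lemma cpoly_opC (k : R[i]) A : cpoly_op k%:P A = scalar_op k.
Proof.
rewrite (@cpoly_op_wide 1) ?size_polyC ?leq_b1// big_ord1 coefC eqxx expr0.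
by [].
Qed.

Lemma cpoly_opXM P A : cpoly_op (P * 'X) A = cpoly_op P A * A.
Proof.
rewrite (@cpoly_op_wide (size P).+1); last first.
  by apply: leq_trans (size_polyMleq _ _) _; rewrite size_polyX addn2.
rewrite big_ord_recl coefMX eqxx scale0r add0r mulr_suml.
by apply: eq_bigr => i _; rewrite coefMX /= /bump /= add1n exprSr bopZlM.
Qed.

Lemma cpoly_opD P Q A : cpoly_op (P + Q) A = cpoly_op P A + cpoly_op Q A.
Proof. by rewrite -[P in LHS]scale1r cpoly_opP scale1r. Qed.

Lemma cpoly_opZ k P A : cpoly_op (k *: P) A = k *: cpoly_op P A.
Proof.
rewrite -[k *: P]addr0 cpoly_opP -[0 : {poly R[i]}]polyC0 cpoly_opC.
by rewrite /scalar_op scale0r addr0.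
Qed.

Lemma cpoly_opM P Q A : cpoly_op (P * Q) A = cpoly_op P A * cpoly_op Q A.
Proof.
elim/poly_ind: Q => [|Q c IH].
  by rewrite mulr0 -polyC0 cpoly_opC /scalar_op scale0r mulr0.
rewrite mulrDr mulrA [P * c%:P]mulrC mul_polyC !cpoly_opD !cpoly_opXM IH.
by rewrite cpoly_opZ cpoly_opC mulrDr mulrA /scalar_op bopZrM mulr1.
Qed.

Lemma cpoly_opXsubC (z : R[i]) A : cpoly_op ('X - z%:P) A = A - scalar_op z.
Proof.
rewrite -polyCN cpoly_opD cpoly_opC -['X]mul1r cpoly_opXM.
by rewrite -[1]/(1%:P) cpoly_opC /scalar_op scale1r mul1r scaleNr.
Qed.

(** Half of the spectral mapping theorem: P(A) is a nonzero multiple of a product of operators A - z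
    over the roots z of [P]. *)
Lemma invertible_cpoly_op P A : P != 0 ->
  (forall z, root P z -> invertible_op (A - scalar_op z)) ->
  invertible_op (cpoly_op P A).
Proof.
have [rs ->] := closed_field_poly_normal P; set k := lead_coef P => Pk hA.
have k0 : k != 0 by apply: contraNneq Pk => ->; rewrite scale0r.
rewrite cpoly_opZ; apply: invertible_opZ => //.
have {hA} : forall z, z \in rs -> invertible_op (A - scalar_op z).
  by move=> z zrs; apply: hA; rewrite rootZ// root_prod_XsubC.
elim: rs {Pk} => [_|z rs IH hA].
  rewrite big_nil -[1]/(1%:P) cpoly_opC /scalar_op scale1r.
  by exists 1; rewrite mul1r.
rewrite big_cons cpoly_opM cpoly_opXsubC; apply: invertible_opM.
  by apply: hA; rewrite mem_head.
by apply: IH => w wrs; apply: hA; rewrite inE wrs orbT.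
Qed.

End Complex.

Lemma poly_opE p A : poly_op p A = cpoly_op (map_poly (real_complex R) p) A.
Proof.
rewrite /cpoly_op size_map_poly; apply: eq_bigr => i _.
by rewrite coef_map.
Qed.

Lemma poly_opD p q A : poly_op (p + q) A = poly_op p A + poly_op q A.
Proof. by rewrite !poly_opE rmorphD cpoly_opD. Qed.

Lemma poly_opZ (c : R) p A : poly_op (c *: p) A = c%:C *: poly_op p A.
Proof. by rewrite !poly_opE map_polyZ cpoly_opZ. Qed.

Lemma poly_opN p A : poly_op (- p) A = - poly_op p A.
Proof. by rewrite -scaleN1r poly_opZ rmorphN1 scaleN1r. Qed.

Lemma poly_opB p q A : poly_op (p - q) A = poly_op p A - poly_op q A.
Proof. by rewrite poly_opD poly_opN. Qed.

Lemma poly_opM p q A : poly_op (p * q) A = poly_op p A * poly_op q A.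
Proof. by rewrite !poly_opE rmorphM cpoly_opM. Qed.

Lemma poly_opC (c : R) A : poly_op c%:P A = scalar_op c%:C.
Proof. by rewrite poly_opE map_polyC cpoly_opC. Qed.

Lemma poly_op1 A : poly_op 1 A = 1.
Proof. by rewrite -[1 in LHS]/(1%:P) poly_opC /scalar_op scale1r. Qed.

Lemma poly_opX A : poly_op 'X A = A.
Proof.
rewrite poly_opE map_polyX -['X]subr0 -[0]/(0%:P) cpoly_opXsubC.
by rewrite /scalar_op scale0r subr0.
Qed.

Lemma poly_op_sum n (F : 'I_n -> {poly R}) A :
  poly_op (\sum_i F i) A = \sum_i poly_op (F i) A.
Proof.
elim/big_rec2: _ => [|i B p _ <-]; last by rewrite poly_opD.
by rewrite -polyC0 poly_opC /scalar_op scale0r.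
Qed.

Lemma selfadjoint_poly_op p A : selfadjoint A -> selfadjoint (poly_op p A).
Proof.
move=> sA; apply: selfadjoint_sum => i.
exact/selfadjointZ/selfadjointX.
Qed.

(** [H] may be the zero space, and this is the only case of an empty spectrum: otherwise A - (c +
    1), with [c] a norm bound of [A], would have a nonnegative form by [qform_ge0_spectrum],
    although its form is at most -|x|^2. *)
Lemma spectrum_empty A : selfadjoint A ->
  (forall t : R, ~ spectrum A t%:C) -> forall x, x = 0.
Proof.
move=> sA A0 x.
have invA t : invertible_op (A - scalar_op t%:C).
  by apply: contrapT; exact: (A0 t).
have [c c0 hc] := bop_bound A.
have sAc : selfadjoint (A - scalar_op (c + 1)%:C).
  by apply: selfadjointB => //; exact: selfadjoint_scalar.
have h : 0 <= qform (A - scalar_op (c + 1)%:C) x.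
  apply: qform_ge0_spectrum => // t _.
  by rewrite -addrA -opprD /scalar_op -scalerDl -rmorphD; exact: invA.
move: h; rewrite qformB qform_scalar => h.
have := le_trans (rdot_le (A x) x) (ler_wpM2r (rnorm_ge0 x) (hc x)).
rewrite -/(qform A x) -mulrA -expr2 => h2.
have /eqP : rnorm x ^+ 2 = 0 by apply/le_anti; rewrite sqr_ge0 andbT; lra.
by rewrite sqrf_eq0 => /eqP/rnorm_eq0.
Qed.

(* If [p(A) - t] is not invertible, then some root [z] of [p - t] is in the
   spectrum of [A], so that [t = p(z)]. *)
Lemma poly_op_ge0 p A : selfadjoint A ->
  (forall z : R[i], spectrum A z -> complex.Im z = 0) ->
  (forall t : R, spectrum A t%:C -> 0 <= p.[t]) ->
  forall x, 0 <= qform (poly_op p A) x.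
Proof.
move=> sA realA pA; apply: qform_ge0_spectrum => [|t t0].
  exact: selfadjoint_poly_op.
pose P := map_poly (real_complex R) (p - t%:P).
have -> : poly_op p A - scalar_op t%:C = cpoly_op P A.
  by rewrite -poly_opE poly_opB poly_opC.
have Pr (s : R) : P.[s%:C] = (p.[s] - t)%:C.
  by rewrite /P horner_map /= hornerD hornerN hornerC.
(* Here [p] is the negative constant [t], so the hypothesis on [p] leaves no real spectrum and [H]
   is the zero space. *)
have [P0|P0] := eqVneq P 0.
  have A0 s : ~ spectrum A s%:C.
    move=> /pA; have := Pr s; rewrite P0 horner0 => /esym/eqP.
    by rewrite fmorph_eq0 subr_eq0 => /eqP->; rewrite leNgt t0.
  have zH := spectrum_empty sA A0.
  by exists 1; split; apply: bop_ext => x; rewrite (zH (_ x)) (zH ((1 : bop H) x)).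
apply: invertible_cpoly_op => // z Pz; apply: contrapT => zA.
move: (realA z zA); case: z Pz zA => a b /= Pz zA b0; rewrite b0 in Pz zA.
move: Pz; rewrite /root -[a +i* 0]/(a%:C) Pr fmorph_eq0 subr_eq0 => /eqP pa.
by have := pA a zA; rewrite pa leNgt t0.
Qed.

End PolynomialCalculus.

(** * Functional calculus of a self-adjoint operator with spectrum in [m, M] *)

Section FunctionalCalculus.
Context (R : realType) (H : hilbertType R).
Variables (A : bop H) (m M : R).
Hypothesis sA : selfadjoint A.
Hypothesis specA : forall z : R[i], spectrum A z -> m%:C <= z <= M%:C.
Implicit Types (x y : H) (B : bop H) (p q : {poly R}) (f : R -> R).

Let specA_Im (z : R[i]) : spectrum A z -> complex.Im z = 0.
Proof. by move=> /specA; rewrite lecE => /andP[/andP[/eqP-> _] _]. Qed.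

Let specA_itv (t : R) : spectrum A t%:C -> m <= t <= M.
Proof. by move=> /specA; rewrite !lecR. Qed.

Lemma poly_op_itv_ge0 p x : (forall t, m <= t <= M -> 0 <= p.[t]) ->
  0 <= qform (poly_op p A) x.
Proof. by move=> p0; apply: poly_op_ge0 => // t /specA_itv/p0. Qed.

Lemma poly_op_itv_le p q x : (forall t, m <= t <= M -> p.[t] <= q.[t]) ->
  qform (poly_op p A) x <= qform (poly_op q A) x.
Proof.
move=> pq; rewrite -subr_ge0 -qformB -poly_opB.
by apply: poly_op_itv_ge0 => t /pq; rewrite hornerD hornerN subr_ge0.
Qed.

Lemma poly_op_norm_le p (e : R) x : 0 < e ->
  (forall t, m <= t <= M -> `|p.[t]| <= e) ->
  rnorm (poly_op p A x) <= e * rnorm x.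
Proof.
move=> e0 pe; apply: norm_le_qform => //; first exact: selfadjoint_poly_op.
move=> y; rewrite -qform_scalar -(poly_opC e A) ler_norml; apply/andP; split.
  rewrite -[leLHS]mulN1r -qformZ -poly_opZ; apply: poly_op_itv_le => t /pe.
  by rewrite hornerZ hornerC mulN1r ler_norml => /andP[].
by apply: poly_op_itv_le => t /pe; rewrite hornerC ler_norml => /andP[].
Qed.

Let is_funcalc_approx f B (e : R) : is_funcalc f A B -> 0 < e ->
  exists2 p, (forall t, spectrum A t%:C -> `|p.[t] - f t| <= e) &
    forall x, rnorm ((poly_op p A - B) x) <= e * rnorm x.
Proof.
move=> fAB /fAB[p [pf pB]]; exists p => // x.
by rewrite -lecR rmorphM /= -!normE; exact: pB.
Qed.

Lemma is_funcalc_selfadjoint f B : is_funcalc f A B -> selfadjoint B.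
Proof.
move=> fAB.
have rB x y : rdot (B x) y = rdot x (B y).
  apply/eqP; rewrite -subr_eq0 -normr_le0; apply/ler_addgt0Pr => d d0.
  rewrite add0r; set c := rnorm x * rnorm y.
  have c0 : 0 <= c by rewrite mulr_ge0 ?rnorm_ge0.
  have e0 : 0 < d / (2 * c + 1) by rewrite divr_gt0//; lra.
  have [p _ pB] := is_funcalc_approx fAB e0.
  have sp := @selfadjoint_poly_op R H p A sA.
  have -> : rdot (B x) y - rdot x (B y) =
      rdot x ((poly_op p A - B) y) - rdot ((poly_op p A - B) x) y.
    by rewrite !bopBE rdotBr rdotBl (selfadjoint_rdot _ _ sp); ring.
  apply: le_trans (ler_normB _ _) _.
  have h1 := le_trans (rdot_norm_le _ _) (ler_wpM2r (rnorm_ge0 y) (pB x)).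
  have h2 := le_trans (rdot_norm_le _ _) (ler_wpM2l (rnorm_ge0 x) (pB y)).
  apply: le_trans (lerD h2 h1) _.
  have -> : rnorm x * (d / (2 * c + 1) * rnorm y) + d / (2 * c + 1) * rnorm x * rnorm y
     = d * (2 * c) / (2 * c + 1) by rewrite /c; ring.
  by rewrite ler_pdivrMr ?ler_wpM2l ?(ltW d0)//; lra.
move=> x y; apply/eqP; rewrite eq_complex; apply/andP; split; apply/eqP.
  exact: rB.
(* Symmetry of the real part is enough: the imaginary part is the real part after multiplying the
   first argument by -i. *)
have Im_rdot u v : complex.Im (hdot u v) = rdot (- 'i *: u) v.
  rewrite /rdot linearZl_LR /=; case: (hdot u v) => a b /=.
  by rewrite oppr0 mul0r mulN1r opprK add0r.
rewrite !Im_rdot -rB; congr rdot.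
by apply/esym; exact: linearZ.
Qed.

(** An approximating polynomial [q] satisfies q <= p + e on the spectrum, and q(A) is within [e] of
    [B]; these two errors account for 2 c in the choice of the tolerance. *)
Lemma is_funcalc_le_poly f B p x : is_funcalc f A B ->
  (forall t, m <= t <= M -> f t <= p.[t]) -> qform B x <= qform (poly_op p A) x.
Proof.
move=> fAB fp; apply/ler_addgt0Pr => d d0.
set c := rnorm x ^+ 2; have c0 : 0 <= c by exact: sqr_ge0.
have e0 : 0 < d / (2 * c + 1) by rewrite divr_gt0//; lra.
have [q qf qB] := is_funcalc_approx fAB e0.
set e := d / _ in e0 qf qB.
have h1 : 0 <= qform (poly_op (p + e%:P - q) A) x.
  apply: poly_op_ge0 => // t tA; have := qf t tA; have := fp t (specA_itv tA).
  by rewrite hornerD hornerN hornerD hornerC ler_norml => h /andP[_ h']; lra.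
rewrite poly_opB poly_opD poly_opC qformB qformD qform_scalar -/c in h1.
have h2 : - (e * c) <= qform (poly_op q A - B) x.
  have := le_trans (rdot_norm_le _ _) (ler_wpM2r (rnorm_ge0 x) (qB x)).
  by rewrite -mulrA -expr2 ler_norml => /andP[].
rewrite qformB in h2.
have h3 : 2 * (e * c) <= d.
  have -> : 2 * (e * c) = d * (2 * c) / (2 * c + 1) by rewrite /e; ring.
  by rewrite ler_pdivrMr ?ler_wpM2l ?(ltW d0)//; lra.
lra.
Qed.

Lemma is_funcalcN f B : is_funcalc f A B -> is_funcalc (fun t => - f t) A (- B).
Proof.
move=> fAB e /fAB[p [pf pB]]; exists (- p); split=> [t /pf|x].
  by rewrite hornerN -opprD normrN.
have -> : poly_op (- p) A - - B = - (poly_op p A - B).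
  by rewrite poly_opN opprK opprB addrC.
by rewrite [X in `|X|](_ : _ = - ((poly_op p A - B) x)) ?normrN.
Qed.

Lemma poly_le_is_funcalc f B p x : is_funcalc f A B ->
  (forall t, m <= t <= M -> p.[t] <= f t) -> qform (poly_op p A) x <= qform B x.
Proof.
move=> /is_funcalcN fAB pf.
have := @is_funcalc_le_poly _ _ (- p) x fAB.
rewrite poly_opN !qformN lerN2; apply=> t /pf.
by rewrite hornerN lerN2.
Qed.

Lemma is_funcalc_exists f (L : R) : m < M ->
  (forall s t, m <= s <= M -> m <= t <= M -> `|f s - f t| <= L * `|s - t|) ->
  exists B, is_funcalc f A B.
Proof.
move=> mM fL.
have appr n : exists p, forall t, m <= t <= M -> `|p.[t] - f t| <= n.+1%:R^-1.
  have [|k [t [b [_ _ _ _ h]]]] := bernstein_approx mM _ fL (e := n.+1%:R^-1).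
    by rewrite invr_gt0 ltr0n.
  by exists (\sum_i f (t i) *: b i).
pose p n := projT1 (cid (appr n)).
have pf n t : m <= t <= M -> `|(p n).[t] - f t| <= n.+1%:R^-1.
  by rewrite /p; case: cid => q /= h /h.
(* Approximant [n] and any later one are each within 1/(n + 1) of [f]. *)
pose e n : R := 2 / n.+1%:R.
have e0 : vanishing e.
  move=> d d0; exists (Num.truncn (2 / d)).
  by rewrite /e ler_pdivrMr ?ltr0n// mulrC -ler_pdivrMr// ltW// truncnS_gt.
have en n : 0 < e n by rewrite divr_gt0 ?ltr0n.
have [|B hB] := @bop_complete R H (fun n => poly_op (p n) A) e e0.
  move=> n k x; rewrite -poly_opB; apply: poly_op_norm_le => // t tm.
  rewrite hornerD hornerN.
  have -> : (p (n + k)%N).[t] - (p n).[t] =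
      ((p (n + k)%N).[t] - f t) - ((p n).[t] - f t) by ring.
  apply: le_trans (ler_normB _ _) _; apply: le_trans (lerD (pf _ _ tm) (pf _ _ tm)) _.
  rewrite /e mulrDl mul1r lerD// lef_pV2 ?posrE ?ltr0n// ler_nat ltnS leq_addr.
  by [].
exists B => d d0; have [n hn] := e0 d d0; exists (p n); split=> [t /specA_itv tm|x].
  apply: le_trans (pf _ _ tm) _; apply: le_trans hn.
  by rewrite /e mulrDl mul1r lerDl invr_ge0 ler0n.
rewrite !normE -rmorphM lecR; apply: le_trans (hB n x) _.
by rewrite ler_wpM2r ?rnorm_ge0.
Qed.

Section Powers.
Hypotheses (m0 : 0 < m) (mM : m < M).
Variable r : R.

(** Existence of a limit rules out the default value 0 in [funcalc]; from here on the power is known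
    only through [is_funcalc]. *)
Lemma op_powR_funcalc : is_funcalc (fun t => t `^ r) A (op_powR A r).
Proof.
have [L _ hL] := powR_lipschitz r M m0.
have [B hB] := is_funcalc_exists mM hL.
rewrite /op_powR /funcalc.
exact: (@xgetPex _ 0 [set B | is_funcalc (fun t => t `^ r) A B]%classic (ex_intro _ B hB)).
Qed.

Lemma op_powR_selfadjoint : selfadjoint (op_powR A r).
Proof. exact: is_funcalc_selfadjoint op_powR_funcalc. Qed.

Lemma op_powR_le_poly p x : (forall t, m <= t <= M -> t `^ r <= p.[t]) ->
  qform (op_powR A r) x <= qform (poly_op p A) x.
Proof. exact: is_funcalc_le_poly op_powR_funcalc. Qed.

Lemma poly_le_op_powR p x : (forall t, m <= t <= M -> p.[t] <= t `^ r) ->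
  qform (poly_op p A) x <= qform (op_powR A r) x.
Proof. exact: poly_le_is_funcalc op_powR_funcalc. Qed.

End Powers.

End FunctionalCalculus.

(** * Jensen's inequality *)

Section DiscreteJensen.
Context (R : realType) (K : hilbertType R).
Variables (T : bop K) (m M : R) (n : nat) (t : 'I_n -> R) (Q : 'I_n -> bop K).
Hypothesis sT : selfadjoint T.
Hypothesis specT : forall z : R[i], spectrum T z -> m%:C <= z <= M%:C.
Hypotheses (m0 : 0 < m) (mM : m < M).
Hypothesis tm : forall i, m <= t i <= M.
Hypothesis sQ : forall i, selfadjoint (Q i).
Hypothesis Q0 : forall i x, 0 <= qform (Q i) x.
Hypothesis sumQ : \sum_i Q i = 1.
Hypothesis sumtQ : \sum_i (t i)%:C *: Q i = T.
Implicit Types (g : R -> R) (h p : {poly R}) (x y : K) (e l c : R).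

(* [g(T) <= \sum_i g (t i) *: Q i], with [g(T)] approached by polynomials. *)
Definition jensen g := forall e, 0 < e -> exists2 h,
  (forall s, m <= s <= M -> g s - e <= h.[s]) &
  forall y, qform (poly_op h T) y <= \sum_i g (t i) * qform (Q i) y.

Let sum_qformQ x : \sum_i qform (Q i) x = rnorm x ^+ 2.
Proof. by rewrite -qform_sum sumQ qform1. Qed.

Let sum_tqformQ x : \sum_i t i * qform (Q i) x = qform T x.
Proof.
by rewrite -sumtQ qform_sum; apply: eq_bigr => i _; rewrite qformZ.
Qed.

Lemma jensen_approx g :
  (forall e, 0 < e -> exists2 g', jensen g' &
     forall s, m <= s <= M -> `|g' s - g s| <= e) -> jensen g.
Proof.
move=> gg e e0; have e2 : 0 < e / 4 by lra.
have [g' Jg' g'g] := gg _ e2.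
have [h hg hQ] := Jg' _ e2.
(* Lowering [h] by e/4 pays for replacing g' by [g] at the nodes, since the [Q i] sum to 1. *)
exists (h - (e / 4)%:P) => [s sm|y].
  rewrite hornerD hornerN hornerC; have := hg s sm; have := g'g s sm.
  by rewrite ler_norml => /andP[? ?] ?; lra.
rewrite poly_opB poly_opC qformB qform_scalar.
apply: (@le_trans _ _ (\sum_i (g' (t i) - e / 4) * qform (Q i) y)).
  under eq_bigr do rewrite mulrBl.
  by rewrite sumrB -mulr_sumr sum_qformQ lerD2r.
apply: ler_sum => i _; apply: ler_wpM2r => //.
by have := g'g _ (tm i); rewrite ler_norml => /andP[? ?]; lra.
Qed.

Lemma jensen_ext g g' : jensen g -> (forall s, m <= s <= M -> g s = g' s) -> jensen g'.
Proof.
move=> Jg gg'; apply: jensen_approx => e e0; exists g => // s /gg'->.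
by rewrite subrr normr0 ltW.
Qed.

Lemma jensenD g g' : jensen g -> jensen g' -> jensen (fun s => g s + g' s).
Proof.
move=> Jg Jg' e e0; have e2 : 0 < e / 2 by lra.
have [h hg hQ] := Jg _ e2; have [h' hg' hQ'] := Jg' _ e2.
exists (h + h') => [s sm|y].
  by rewrite hornerD; have := hg s sm; have := hg' s sm; lra.
rewrite poly_opD qformD; under eq_bigr do rewrite mulrDl.
by rewrite big_split lerD.
Qed.

Lemma jensenZ c g : 0 <= c -> jensen g -> jensen (fun s => c * g s).
Proof.
move=> c0 Jg e e0; have c1 : 0 < c + 1 by lra.
have [h hg hQ] := Jg _ (divr_gt0 e0 c1).
exists (c *: h) => [s sm|y].
  rewrite hornerZ; apply: le_trans (ler_wpM2l c0 (hg s sm)).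
  rewrite mulrBr lerD2l lerN2 mulrA ler_pdivrMr// mulrC ler_wpM2l ?(ltW e0)//; lra.
rewrite poly_opZ qformZ; under eq_bigr do rewrite -mulrA.
by rewrite -mulr_sumr ler_wpM2l.
Qed.

Lemma jensen_affine a b : jensen (fun s => a * s + b).
Proof.
move=> e e0; exists (a *: 'X + b%:P) => [s _|y].
  by rewrite !hornerE; lra.
rewrite poly_opD poly_opZ poly_opX poly_opC qformD qformZ qform_scalar.
under eq_bigr do rewrite mulrDl -mulrA.
by rewrite big_split /= -!mulr_sumr sum_tqformQ sum_qformQ.
Qed.

Lemma jensen_sum k (F : 'I_k -> R -> R) : (forall i, jensen (F i)) ->
  jensen (fun s => \sum_i F i s).
Proof.
elim: k F => [|k IH] F JF.
  by apply: jensen_ext (jensen_affine 0 0) _ => s _; rewrite big_ord0 mul0r addr0.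
apply: jensen_ext (jensenD (JF ord0) (IH _ (fun i => JF (lift ord0 i)))) _ => s _.
by rewrite big_ord_recl.
Qed.

(* For every [x], positivity of [Q i] at [y - (l + t i) *: x] yields
   [\sum_i qform (Q i) y / (l + t i) >= 2 * rdot x y - qform (l + T) x];
   the best choice [x = (l + T)^-1 y] is approached by [x = p(T) y]. *)
Lemma jensen_resolvent l : 0 <= l -> jensen (fun s => 1 / (l + s)).
Proof.
move=> l0 e e0.
have lM : 0 < l + M by rewrite ltr_wpDl// (lt_trans m0 mM).
have lm : 0 < l + m by rewrite ltr_wpDl.
have [L _ hL] := powR_lipschitz (-1) (l + M) lm.
have fL s s' : m <= s <= M -> m <= s' <= M ->
    `|1 / (l + s) - 1 / (l + s')| <= L * `|s - s'|.
  move=> /andP[ms sM] /andP[ms' sM'].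
  have := hL (l + s) (l + s'); rewrite !lerD2l ms sM ms' sM' => /(_ isT isT).
  rewrite opprD addrACA subrr add0r !powR_inv1 ?div1r//; lra.
(* The error of [p] enters squared and multiplied by l + s: the minimum with 1 gives d^2 <= d, and
   (l + M) d <= e. *)
pose d := Num.min 1 (e / (l + M)).
have d0 : 0 < d by rewrite lt_min ltr01 divr_gt0.
have [k [u [b [_ _ _ _ hp]]]] := bernstein_approx mM d0 fL.
set p := \sum_i _ in hp.
(* This is 2 <x, y> - <(l + T) x, x> at x = p(T) y, and also Newton's iterate for the inverse: with
   f = 1/(l + s) it equals f - (l + s) (p - f)^2. *)
exists (2 *: p - p * (('X + l%:P) * p)) => [s sm|y].
  have := hp s sm; have s0 : 0 < l + s by have /andP[? _] := sm; lra.
  set f := 1 / (l + s); set q := p.[s] => pf.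
  rewrite hornerD hornerN hornerZ !hornerM hornerD hornerX hornerC -/q.
  have ff : (l + s) * f = 1 by rewrite /f mul1r divff ?gt_eqF.
  have -> : 2 * q - q * ((s + l) * q) = f - (l + s) * (q - f) ^+ 2.
    have -> : f - (l + s) * (q - f) ^+ 2 =
       f * (1 - (l + s) * f) + 2 * q * ((l + s) * f) - q * ((s + l) * q) by ring.
    by rewrite ff subrr mulr0 add0r mulr1.
  rewrite lerD2l lerN2.
  have qf2 : (q - f) ^+ 2 <= d.
    rewrite -real_normK ?num_real// expr2; apply: (@le_trans _ _ (d * 1)); last by rewrite mulr1.
    apply: ler_pM => //; apply: le_trans pf _; by rewrite ge_min lexx.
  apply: (@le_trans _ _ ((l + M) * d)).
    apply: ler_pM => //; [exact: ltW|exact: sqr_ge0|].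
    by have /andP[_ ?] := sm; rewrite lerD2l.
  by rewrite mulrC -ler_pdivlMr// ge_min lexx orbT.
rewrite poly_opB poly_opZ !poly_opM poly_opD poly_opX poly_opC.
set P := poly_op p T; pose x := P y.
have sP : selfadjoint P by exact: selfadjoint_poly_op.
have -> : qform (2%:C *: P - P * ((T + scalar_op l%:C) * P)) y =
    2 * rdot x y - (qform T x + l * rnorm x ^+ 2).
  rewrite qformB qformZ; congr (_ - _).
  rewrite /qform !bopME (selfadjoint_rdot _ _ sP) -/x bopDE rdotDl.
  by rewrite bop_scalarE rdotZl rdotxx.
have tl i : 0 < l + t i by have /andP[? _] := tm i; rewrite ltr_wpDl// (lt_le_trans m0).
have : 0 <= \sum_i (l + t i)^-1 * qform (Q i) (y - (l + t i)%:C *: x).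
  by apply: sumr_ge0 => i _; rewrite mulr_ge0 ?invr_ge0 ?(ltW (tl i)).
have -> : \sum_i (l + t i)^-1 * qform (Q i) (y - (l + t i)%:C *: x) =
   \sum_i 1 / (l + t i) * qform (Q i) y - 2 * rdot x y + (qform T x + l * rnorm x ^+ 2).
  rewrite -sum_tqformQ -sum_qformQ mulr_sumr -big_split /=.
  have -> : 2 * rdot x y = \sum_i 2 * rdot (Q i y) x.
    by rewrite -mulr_sumr -rdot_suml -bop_sumE sumQ rdotC.
  rewrite -sumrB -big_split /=; apply: eq_bigr => i _.
  rewrite /qform bopBr bopZr !(rdotBl, rdotBr, rdotZl, rdotZr).
  rewrite (selfadjoint_rdot x y (sQ i)) (rdotC x (Q i y)).
  by field; rewrite gt_eqF.
by move=> h; lra.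
Qed.

(** The affine terms come from division: s/(l + s) = 1 - l/(l + s) and s^2/(l + s) = s - l + l^2/(l
    + s). *)
Lemma jensen_resolvent_sum k (a b c l : 'I_k -> R) :
  (forall i, 0 <= c i) -> (forall i, 0 <= l i) ->
  jensen (fun s => \sum_i (a i * s + b i + c i * (1 / (l i + s)))).
Proof.
move=> c0 l0; apply: jensen_sum => i.
by apply: jensenD; [exact: jensen_affine|apply: jensenZ => //; exact: jensen_resolvent].
Qed.

Let sgt0 s : m <= s <= M -> 0 < s.
Proof. by move=> /andP[ms _]; exact: lt_le_trans ms. Qed.

Let powR_succ s r : m <= s <= M -> s `^ r = s * s `^ (r - 1).
Proof.
move=> /sgt0 s0; rewrite powRB ?(gt_eqF s0) ?implybT// powRr1 ?(ltW s0)//.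
by rewrite mulrCA divff ?gt_eqF// mulr1.
Qed.

Lemma jensen_powRN r : -1 <= r <= 0 -> jensen (fun s => s `^ r).
Proof.
move=> r01; apply: jensen_approx => e e0.
have [k [a [l [a0 l0 h]]]] := powR_resolvent_approx m0 mM r01 e0.
exists (fun s => \sum_i (0 * s + 0 + a i * (1 / (l i + s)))).
  exact: (@jensen_resolvent_sum k (fun=> 0) (fun=> 0)).
move=> s sm; under eq_bigr do rewrite mul0r !add0r mul1r.
exact: h.
Qed.

(** Multiplying the approximation of s^(r - 1) by -s turns each resolvent into -1 + l/(l + s), again
    with a nonnegative resolvent coefficient. Tolerance e/M allows for the factor s <= M. *)
Lemma jensen_powR01 r : 0 <= r <= 1 -> jensen (fun s => - s `^ r).
Proof.
move=> r01; apply: jensen_approx => e e0.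
have M0 := lt_trans m0 mM.
have r1 : -1 <= r - 1 <= 0 by lra.
have [k [a [l [a0 l0 h]]]] := powR_resolvent_approx m0 mM r1 (divr_gt0 e0 M0).
exists (fun s => \sum_i (0 * s + - a i + a i * l i * (1 / (l i + s)))).
  by apply: (@jensen_resolvent_sum k (fun=> 0)) => // i; rewrite mulr_ge0.
move=> s sm; have s0 := sgt0 sm.
have -> : \sum_i (0 * s + - a i + a i * l i * (1 / (l i + s))) =
    - (s * \sum_i a i / (l i + s)).
  rewrite mulr_sumr -sumrN; apply: eq_bigr => i _.
  by field; rewrite gt_eqF// ltr_wpDl.
rewrite (powR_succ _ sm) -opprD normrN -mulrN -mulrDr normrM (gtr0_norm s0).
have -> : e = M * (e / M) by rewrite mulrCA divff ?mulr1// gt_eqF.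
by apply: ler_pM; rewrite ?(ltW s0)//; [case/andP: sm|exact: h].
Qed.

Lemma jensen_powR12 r : 1 <= r <= 2 -> jensen (fun s => s `^ r).
Proof.
move=> r12; apply: jensen_approx => e e0.
have M0 := lt_trans m0 mM.
have r1 : -1 <= r - 1 - 1 <= 0 by lra.
have MM0 : 0 < M ^+ 2 by rewrite exprn_gt0.
have [k [a [l [a0 l0 h]]]] := powR_resolvent_approx m0 mM r1 (divr_gt0 e0 MM0).
exists (fun s => \sum_i (a i * s + - (a i * l i) + a i * l i ^+ 2 * (1 / (l i + s)))).
  by apply: (@jensen_resolvent_sum k a) => // i; rewrite mulr_ge0 ?sqr_ge0.
move=> s sm; have s0 := sgt0 sm.
have -> : \sum_i (a i * s + - (a i * l i) + a i * l i ^+ 2 * (1 / (l i + s))) =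
    s ^+ 2 * \sum_i a i / (l i + s).
  rewrite mulr_sumr; apply: eq_bigr => i _.
  by field; rewrite gt_eqF// ltr_wpDl.
rewrite (powR_succ _ sm) (powR_succ _ sm) mulrA -expr2 -mulrBr normrM.
rewrite ger0_norm ?sqr_ge0//.
have -> : e = M ^+ 2 * (e / M ^+ 2) by rewrite mulrCA divff ?mulr1// gt_eqF.
apply: ler_pM; rewrite ?sqr_ge0//; last exact: h.
by rewrite ler_sqr ?nnegrE ?(ltW s0) ?(ltW M0)//; case/andP: sm.
Qed.

Lemma jensen_op_powR_le r y : jensen (fun s => s `^ r) ->
  qform (op_powR T r) y <= \sum_i t i `^ r * qform (Q i) y.
Proof.
move=> J; apply/ler_addgt0Pr => e e0.
have y1 : 0 < rnorm y ^+ 2 + 1 by rewrite ltr_wpDl ?sqr_ge0.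
have [h hg hQ] := J _ (divr_gt0 e0 y1); set d := e / _ in hg.
have dy : d * rnorm y ^+ 2 <= e.
  by rewrite /d mulrAC ler_pdivrMr// ler_wpM2l ?(ltW e0)// lerDl.
have := @op_powR_le_poly _ _ T m M sT specT m0 mM r (h + d%:P) y.
rewrite poly_opD poly_opC qformD qform_scalar => h1.
apply: le_trans (h1 _) _; last by rewrite lerD.
by move=> s sm; rewrite hornerD hornerC; have := hg s sm; lra.
Qed.

Lemma jensen_op_powR_ge r y : jensen (fun s => - s `^ r) ->
  \sum_i t i `^ r * qform (Q i) y <= qform (op_powR T r) y.
Proof.
move=> J; apply/ler_addgt0Pr => e e0.
have y1 : 0 < rnorm y ^+ 2 + 1 by rewrite ltr_wpDl ?sqr_ge0.
have [h hg hQ] := J _ (divr_gt0 e0 y1); set d := e / _ in hg.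
have dy : d * rnorm y ^+ 2 <= e.
  by rewrite /d mulrAC ler_pdivrMr// ler_wpM2l ?(ltW e0)// lerDl.
have := @poly_le_op_powR _ _ T m M sT specT m0 mM r (- (h + d%:P)) y.
rewrite poly_opN qformN poly_opD poly_opC qformD qform_scalar => h1.
have := hQ y; under eq_bigr do rewrite mulNr.
rewrite sumrN => h2.
have {}h1 := h1 _; have {}h1 : - (qform (poly_op h T) y + d * rnorm y ^+ 2) <=
    qform (op_powR T r) y.
  by apply: h1 => s sm; rewrite hornerN hornerD hornerC; have := hg s sm; lra.
move: h1 h2 dy; move: (d * _) => w; lra.
Qed.

End DiscreteJensen.

(** * Unital positive maps and Jensen's inequality for powers *)

Section PositiveMaps.
Context (R : realType) (H K : hilbertType R).
Variable Phi : {linear bop H -> bop K}.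
Hypotheses (Phi1 : unital_map Phi) (Phi0 : positive_map Phi).

Lemma unital_map_scalar (z : R[i]) : Phi (scalar_op z) = scalar_op z.
Proof. by rewrite /scalar_op linearZ Phi1. Qed.

Lemma positive_map_qform_ge0 X y : selfadjoint X -> (forall x, 0 <= qform X x) ->
  0 <= qform (Phi X) y.
Proof. by move=> sX X0; apply/positive_op_qform/Phi0/positive_opP. Qed.

Lemma positive_map_qform_le X Y y : selfadjoint X -> selfadjoint Y ->
  (forall x, qform X x <= qform Y x) -> qform (Phi X) y <= qform (Phi Y) y.
Proof.
move=> sX sY XY; rewrite -subr_ge0 -qformB -linearB.
apply: positive_map_qform_ge0 => [|x]; first exact: selfadjointB.
by rewrite qformB subr_ge0.
Qed.

(** Positivity of [Phi] speaks only of positive operators, so [X] is shifted by a norm bound [c],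
    and Phi(c) = c undoes the shift. *)
Lemma positive_map_selfadjoint X : selfadjoint X -> selfadjoint (Phi X).
Proof.
move=> sX; have [c c0 hc] := bop_bound X.
have sXc : selfadjoint (X + scalar_op c%:C).
  by apply: selfadjointD => //; exact: selfadjoint_scalar.
have [|sP _] := Phi0 (positive_opP sXc _).
  move=> x; rewrite qformD qform_scalar -lerBlDr sub0r lerNl /qform -rdotNl.
  apply: le_trans (rdot_le _ _) _.
  by rewrite rnormN expr2 mulrA ler_wpM2r ?rnorm_ge0.
rewrite -[X](addrK (scalar_op c%:C)) linearB unital_map_scalar.
by apply: selfadjointB => //; exact: selfadjoint_scalar.
Qed.

Lemma positive_map_affine A a b :
  Phi (poly_op (a *: 'X + b%:P) A) = poly_op (a *: 'X + b%:P) (Phi A).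
Proof.
by rewrite !poly_opD !poly_opZ !poly_opX !poly_opC linearD linearZ unital_map_scalar.
Qed.

Section Spectrum.
Variables (A : bop H) (m M : R).
Hypothesis sA : selfadjoint A.
Hypothesis specA : forall z : R[i], spectrum A z -> m%:C <= z <= M%:C.

Lemma positive_map_poly_le p q y : (forall t, m <= t <= M -> p.[t] <= q.[t]) ->
  qform (Phi (poly_op p A)) y <= qform (Phi (poly_op q A)) y.
Proof.
move=> pq; apply: positive_map_qform_le => [||x]; try exact: selfadjoint_poly_op.
exact: poly_op_itv_le sA specA _ _ _ pq.
Qed.

Lemma positive_map_spectrum (z : R[i]) : spectrum (Phi A) z -> m%:C <= z <= M%:C.
Proof.
apply: spectrum_bounds => [|y|y]; first exact: positive_map_selfadjoint.
- have := @positive_map_poly_le m%:P 'X y.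
  rewrite poly_opX poly_opC unital_map_scalar qform_scalar; apply=> t /andP[mt _].
  by rewrite hornerC hornerX.
- have := @positive_map_poly_le 'X M%:P y.
  rewrite poly_opX poly_opC unital_map_scalar qform_scalar; apply=> t /andP[_ tM].
  by rewrite hornerC hornerX.
Qed.

Hypotheses (m0 : 0 < m) (mM : m < M).
Variable r : R.

Let sAr : selfadjoint (op_powR A r). Proof. exact: op_powR_selfadjoint mM r. Qed.
Let sT : selfadjoint (Phi A). Proof. exact: positive_map_selfadjoint. Qed.

Lemma positive_map_op_powR_le p y : (forall t, m <= t <= M -> t `^ r <= p.[t]) ->
  qform (Phi (op_powR A r)) y <= qform (Phi (poly_op p A)) y.
Proof.
move=> fp; apply: positive_map_qform_le => [||x] //; first exact: selfadjoint_poly_op.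
exact: (op_powR_le_poly sA specA m0 mM).
Qed.

Lemma positive_map_poly_le_op_powR p y : (forall t, m <= t <= M -> p.[t] <= t `^ r) ->
  qform (Phi (poly_op p A)) y <= qform (Phi (op_powR A r)) y.
Proof.
move=> pf; apply: positive_map_qform_le => [||x] //; first exact: selfadjoint_poly_op.
exact: (poly_le_op_powR sA specA m0 mM).
Qed.

Lemma positive_map_bernstein (e : R) : 0 < e ->
  exists n (t : 'I_n -> R) (Q : 'I_n -> bop K),
  [/\ (forall i, m <= t i <= M),
      (forall i, selfadjoint (Q i)) /\ (forall i y, 0 <= qform (Q i) y),
      \sum_i Q i = 1, \sum_i (t i)%:C *: Q i = Phi A &
      forall y, `|\sum_i t i `^ r * qform (Q i) y - qform (Phi (op_powR A r)) y|
        <= e * rnorm y ^+ 2].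
Proof.
move=> e0; have [L _ hL] := powR_lipschitz r M m0.
have [n [t [b [tm b0 b1 bX bf]]]] := bernstein_approx mM e0 hL.
exists n, t, (fun i => Phi (poly_op (b i) A)); split=> //.
- split=> [i|i y].
    exact/positive_map_selfadjoint/selfadjoint_poly_op.
  apply: positive_map_qform_ge0; first exact: selfadjoint_poly_op.
  by move=> x; apply: (poly_op_itv_ge0 sA specA); exact: b0.
- by rewrite -linear_sum -poly_op_sum b1 poly_op1.
- under eq_bigr do rewrite -linearZ -poly_opZ.
  by rewrite -linear_sum -poly_op_sum bX poly_opX.
move=> y; set p := \sum_i _ *: _ in bf.
have -> : \sum_i t i `^ r * qform (Phi (poly_op (b i) A)) y = qform (Phi (poly_op p A)) y.
  rewrite poly_op_sum linear_sum qform_sum; apply: eq_bigr => i _.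
  by rewrite poly_opZ linearZ qformZ.
have h1 := @positive_map_op_powR_le (p + e%:P) y.
have h2 := @positive_map_poly_le_op_powR (p - e%:P) y.
rewrite poly_opD poly_opC linearD unital_map_scalar qformD qform_scalar in h1.
rewrite poly_opB poly_opC linearB unital_map_scalar qformB qform_scalar in h2.
rewrite ler_norml lerBlDr lerNl opprB lerBlDr; apply/andP; split.
  rewrite addrC; apply: h1 => s sm.
  by have := bf s sm; rewrite hornerD hornerC ler_norml => /andP[? ?]; lra.
rewrite addrC -lerBlDr; apply: h2 => s sm.
by have := bf s sm; rewrite hornerD hornerN hornerC ler_norml => /andP[? ?]; lra.
Qed.

Lemma op_powR_positive_map_le y : -1 <= r <= 0 \/ 1 <= r <= 2 ->
  qform (op_powR (Phi A) r) y <= qform (Phi (op_powR A r)) y.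
Proof.
move=> hr; apply/ler_addgt0Pr => e e0.
have y1 : 0 < rnorm y ^+ 2 + 1 by rewrite ltr_wpDl ?sqr_ge0.
(* Nodes and operators depend on the tolerance; so [y] is fixed first, and the tolerance is scaled
   to cost at most [e] at [y]. *)
have [n [t [Q [tm [sQ Q0] Q1 QT Qf]]]] := positive_map_bernstein (divr_gt0 e0 y1).
apply: (@le_trans _ _ (\sum_i t i `^ r * qform (Q i) y)).
  apply: (jensen_op_powR_le sT positive_map_spectrum m0 mM) => //.
  by case: hr => hr; [apply: jensen_powRN|apply: jensen_powR12] => //;
     exact: positive_map_spectrum.
have := Qf y; rewrite ler_norml lerBlDl => /andP[_ /le_trans]; apply.
by rewrite lerD2l mulrAC ler_pdivrMr// ler_wpM2l ?(ltW e0)// lerDl.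
Qed.

Lemma op_powR_positive_map_ge y : 0 <= r <= 1 ->
  qform (Phi (op_powR A r)) y <= qform (op_powR (Phi A) r) y.
Proof.
move=> hr; apply/ler_addgt0Pr => e e0.
have y1 : 0 < rnorm y ^+ 2 + 1 by rewrite ltr_wpDl ?sqr_ge0.
have [n [t [Q [tm [sQ Q0] Q1 QT Qf]]]] := positive_map_bernstein (divr_gt0 e0 y1).
apply: (@le_trans _ _ (\sum_i t i `^ r * qform (Q i) y + e)); last first.
  rewrite lerD2r; apply: (jensen_op_powR_ge sT positive_map_spectrum m0 mM) => //.
  by apply: jensen_powR01 => //; exact: positive_map_spectrum.
have := Qf y; rewrite distrC ler_norml lerBlDl => /andP[_ /le_trans]; apply.
by rewrite lerD2l mulrAC ler_pdivrMr// ler_wpM2l ?(ltW e0)// lerDl.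
Qed.

End Spectrum.
End PositiveMaps.

(** * Chord estimates *)

Section ChordEstimates.
Context (R : realType) (H K : hilbertType R).
Variables (Phi : {linear bop H -> bop K}) (A : bop H) (m M r : R).
Hypotheses (Phi1 : unital_map Phi) (Phi0 : positive_map Phi).
Hypotheses (sA : selfadjoint A) (m0 : 0 < m) (mM : m < M).
Hypothesis specA : forall z : R[i], spectrum A z -> m%:C <= z <= M%:C.

Let sT : selfadjoint (Phi A). Proof. exact: positive_map_selfadjoint. Qed.
Let specT := positive_map_spectrum Phi1 Phi0 sA specA.

(** The expanded form of (M - t)(t - m), which evaluates at operators to the brackets of the
    theorem. *)
Definition gap_poly : {poly R} := (M + m) *: 'X - (M * m)%:P - 'X ^+ 2.

Lemma gap_polyE t : gap_poly.[t] = (M - t) * (t - m).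
Proof.
rewrite /gap_poly !hornerD !hornerN hornerZ hornerX hornerC horner_exp hornerX.
by ring.
Qed.

Lemma poly_op_gap (L : hilbertType R) (B : bop L) :
  poly_op gap_poly B = (M + m)%:C *: B - scalar_op (M * m)%:C - B ^+ 2.
Proof. by rewrite !poly_opB poly_opZ poly_opX poly_opC expr2 poly_opM poly_opX. Qed.

Lemma positive_map_gap :
  Phi (poly_op gap_poly A) = (M + m)%:C *: Phi A - scalar_op (M * m)%:C - Phi (A ^+ 2).
Proof. by rewrite poly_op_gap !linearB linearZ /= unital_map_scalar. Qed.

(** Slope and intercept form, the shape that [positive_map_affine] moves through [Phi]. *)
Definition chord_poly : {poly R} :=
  ((M `^ r - m `^ r) / (M - m)) *: 'X + ((M * m `^ r - m * M `^ r) / (M - m))%:P.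

Lemma chord_polyE t : chord_poly.[t] = powR_chord m M r t.
Proof.
rewrite /chord_poly /powR_chord hornerD hornerZ hornerX hornerC.
by field; rewrite subr_eq0 gt_eqF.
Qed.

Lemma gap_ge0 t : m <= t <= M -> 0 <= gap_poly.[t].
Proof. by move=> /andP[mt tM]; rewrite gap_polyE mulr_ge0 ?subr_ge0. Qed.

Lemma qform_gap_ge0 y : 0 <= qform (poly_op gap_poly (Phi A)) y.
Proof. by apply: (poly_op_itv_ge0 sT specT) => t; exact: gap_ge0. Qed.

Lemma qform_map_gap_ge0 y : 0 <= qform (Phi (poly_op gap_poly A)) y.
Proof.
apply: positive_map_qform_ge0 => // [|x]; first exact: selfadjoint_poly_op.
by apply: (poly_op_itv_ge0 sA specA) => t; exact: gap_ge0.
Qed.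

Let k := kantorovich m M r.
Let k0 : 0 < k. Proof. exact: kantorovich_gt0. Qed.

Let chordT : Phi (poly_op chord_poly A) = poly_op chord_poly (Phi A).
Proof. exact: positive_map_affine. Qed.

Section Convex.
Hypothesis hr : r <= 0 \/ 1 <= r.

Lemma chord_le_kantorovich y :
  qform (poly_op chord_poly (Phi A)) y <= k * qform (op_powR (Phi A) r) y.
Proof.
rewrite -ler_pdivrMl// -qformZ -poly_opZ.
apply: (poly_le_op_powR sT specT m0 mM) => t /andP[mt _].
rewrite hornerZ chord_polyE ler_pdivrMl//.
exact: (kantorovich_ge_chord m0 mM (lt_le_trans m0 mt) hr).
Qed.

Lemma chord_le_kantorovich_map y :
  qform (poly_op chord_poly (Phi A)) y <= k * qform (Phi (op_powR A r)) y.
Proof.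
rewrite -chordT -ler_pdivrMl// -qformZ -linearZ -poly_opZ.
apply: (positive_map_poly_le_op_powR Phi0 sA specA m0 mM) => t /andP[mt _].
rewrite hornerZ chord_polyE ler_pdivrMl//.
exact: (kantorovich_ge_chord m0 mM (lt_le_trans m0 mt) hr).
Qed.

Variable c : R.
Hypothesis hc : forall t, m <= t <= M -> c <= r * (r - 1) * t `^ (r - 2).

Let powR_le t : m <= t <= M -> t `^ r <= (chord_poly - (c / 2) *: gap_poly).[t].
Proof.
move=> tm; rewrite hornerD hornerN hornerZ chord_polyE gap_polyE lerBrDr.
have := @powR_chord_curvature R m M r 1 c t m0 mM (expr1n _ _).
by rewrite !mul1r; apply.
Qed.

(** The curvature bound is evaluated at Phi(A), which produces Phi(A)^2; in [map_op_powR_chord] it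
    is evaluated at [A] before [Phi] is applied, which produces Phi(A^2). *)
Lemma op_powR_map_chord y :
  qform (op_powR (Phi A) r) y + c / 2 * qform (poly_op gap_poly (Phi A)) y <=
  qform (poly_op chord_poly (Phi A)) y.
Proof.
have := op_powR_le_poly sT specT m0 mM y powR_le.
by rewrite poly_opB poly_opZ qformB qformZ lerBrDr.
Qed.

Lemma map_op_powR_chord y :
  qform (Phi (op_powR A r)) y + c / 2 * qform (Phi (poly_op gap_poly A)) y <=
  qform (poly_op chord_poly (Phi A)) y.
Proof.
have := positive_map_op_powR_le Phi0 sA specA m0 mM y powR_le.
by rewrite poly_opB poly_opZ linearB linearZ chordT qformB qformZ lerBrDr.
Qed.

End Convex.

Section Concave.
Hypothesis hr : 0 <= r <= 1.

Lemma kantorovich_le_chord_map y :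
  k * qform (op_powR (Phi A) r) y <= qform (poly_op chord_poly (Phi A)) y.
Proof.
rewrite -ler_pdivlMl// -qformZ -poly_opZ.
apply: (op_powR_le_poly sT specT m0 mM) => t /andP[mt _].
rewrite hornerZ chord_polyE ler_pdivlMl//.
exact: (kantorovich_le_chord m0 mM (lt_le_trans m0 mt) hr).
Qed.

Variable c : R.
Hypothesis hc : forall t, m <= t <= M -> c <= r * (1 - r) * t `^ (r - 2).

Lemma chord_le_map_op_powR y :
  qform (poly_op chord_poly (Phi A)) y <=
  qform (Phi (op_powR A r)) y - c / 2 * qform (Phi (poly_op gap_poly A)) y.
Proof.
have h t : m <= t <= M -> (chord_poly + (c / 2) *: gap_poly).[t] <= t `^ r.
  move=> tm; rewrite hornerD hornerZ chord_polyE gap_polyE.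
  have := @powR_chord_curvature R m M r (-1) c t m0 mM.
  rewrite sqrrN expr1n !mulN1r => h1; have {}h1 := h1 erefl _ tm.
  have /h1 : forall y, m <= y <= M -> c <= - (r * (r - 1)) * y `^ (r - 2).
    by move=> s /hc; rewrite -mulrN opprB.
  lra.
have := positive_map_poly_le_op_powR Phi0 sA specA m0 mM y h.
by rewrite poly_opD poly_opZ linearD linearZ chordT qformD qformZ lerBrDr.
Qed.

End Concave.

End ChordEstimates.

Theorem corollary3p2 (R : realType) (H K : hilbertType R) (A : bop H) (m M : R)
    (Phi : {linear bop H -> bop K}) :
  selfadjoint A ->
  0 < m -> m < M ->
  (forall z : R[i], spectrum A z -> m%:C <= z <= M%:C) ->
  unital_map Phi -> positive_map Phi ->
  forall r : R,
  let gamma := r * (r - 1) * Num.min (m `^ (r - 2)) (M `^ (r - 2)) in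
  let k := kantorovich m M r in
  let D := (M + m)%:C *: Phi A - scalar_op (M * m)%:C - Phi (A ^+ 2) in
  let D' := (M + m)%:C *: Phi A - scalar_op (M * m)%:C - Phi A ^+ 2 in
  [/\ r < -1 \/ 2 < r ->
      [/\ (1 / k)%:C *: Phi (A ^oR r) <=L
          (1 / k)%:C *: (Phi (A ^oR r) + (gamma / 2)%:C *: D),
          (1 / k)%:C *: (Phi (A ^oR r) + (gamma / 2)%:C *: D) <=L
          Phi A ^oR r,
          Phi A ^oR r <=L
          k%:C *: Phi (A ^oR r) - (gamma / 2)%:C *: D'
        & k%:C *: Phi (A ^oR r) - (gamma / 2)%:C *: D' <=L
          k%:C *: Phi (A ^oR r)],
      (-1 <= r <= 0) \/ (1 <= r <= 2) ->
      [/\ (1 / k)%:C *: Phi (A ^oR r) <=L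
          (1 / k)%:C *: (Phi (A ^oR r) + (gamma / 2)%:C *: D),
          (1 / k)%:C *: (Phi (A ^oR r) + (gamma / 2)%:C *: D) <=L
          Phi A ^oR r
        & Phi A ^oR r <=L Phi (A ^oR r)]
    & 0 <= r <= 1 ->
      [/\ (1 / k)%:C *: (Phi (A ^oR r) - (r * (1 - r) / (2 * M `^ (2 - r)))%:C *: D) <=L
          (1 / k)%:C *: Phi (A ^oR r),
          Phi A ^oR r <=L
          (1 / k)%:C *: (Phi (A ^oR r) - (r * (1 - r) / (2 * M `^ (2 - r)))%:C *: D)
        & Phi (A ^oR r) <=L Phi A ^oR r]].
Proof.
move=> sA m0 mM specA Phi1 Phi0 r gamma k D D'.
have M0 := lt_trans m0 mM.
have sT : selfadjoint (Phi A) by exact: positive_map_selfadjoint.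
have specT := positive_map_spectrum Phi1 Phi0 sA specA.
have sTr : selfadjoint (Phi A ^oR r) by exact: (op_powR_selfadjoint sT specT m0 mM).
have sAr : selfadjoint (Phi (A ^oR r)).
  by apply: positive_map_selfadjoint => //; exact: (op_powR_selfadjoint sA specA m0 mM).
have DE : D = Phi (poly_op (gap_poly m M) A) by rewrite positive_map_gap.
have D'E : D' = poly_op (gap_poly m M) (Phi A) by rewrite poly_op_gap.
have sD : selfadjoint D.
  by rewrite DE; exact/positive_map_selfadjoint/selfadjoint_poly_op.
have sD' : selfadjoint D' by rewrite D'E; exact: selfadjoint_poly_op.
have D0 y : 0 <= qform D y by rewrite DE; exact: qform_map_gap_ge0.
have D'0 y : 0 <= qform D' y by rewrite D'E; exact: qform_gap_ge0.
have k0 : 0 < k by exact: kantorovich_gt0.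
have kV0 : 0 <= 1 / k by rewrite divr_ge0 ?ler01 ?ltW.
have kd (a b : R) : (1 / k * a <= b) = (a <= k * b) by rewrite div1r ler_pdivrMl.
have kd' (a b : R) : (b <= 1 / k * a) = (k * b <= a) by rewrite div1r ler_pdivlMl.
(* The first two inequalities of (i) and (ii) need only that t^r is convex, so they are proved
   together. *)
have convex : r <= 0 \/ 1 <= r ->
  [/\ 0 <= gamma / 2,
   (1 / k)%:C *: Phi (A ^oR r) <=L (1 / k)%:C *: (Phi (A ^oR r) + (gamma / 2)%:C *: D) &
   (1 / k)%:C *: (Phi (A ^oR r) + (gamma / 2)%:C *: D) <=L Phi A ^oR r].
  move=> hr; have rr : 0 <= r * (r - 1) by case: hr => ?; nra.
  have g0 : 0 <= gamma / 2.
    by rewrite divr_ge0// /gamma mulr_ge0// le_min !powR_ge0.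
  have hg t : m <= t <= M -> gamma <= r * (r - 1) * t `^ (r - 2).
    by move=> tm; rewrite ler_wpM2l//; have /andP[] := powR_bound (r - 2) m0 tm.
  split=> //; apply: loewnerP => [||y];
    try by do ?[exact: selfadjointZ|apply: selfadjointZ|apply: selfadjointD].
  - by rewrite !qformZ qformD qformZ ler_wpM2l// lerDl mulr_ge0.
  - rewrite qformZ qformD qformZ kd.
    have := map_op_powR_chord Phi1 Phi0 sA m0 mM specA hg y; rewrite -DE.
    by move=> /le_trans; apply; exact: chord_le_kantorovich.
split=> hr.
- have hr' : r <= 0 \/ 1 <= r by case: hr => ?; [left|right]; lra.
  have [g0 h1 h2] := convex hr'; split=> //; apply: loewnerP => [||y];
    try by do ?[exact: selfadjointZ|apply: selfadjointZ|apply: selfadjointB].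
  + have hg t : m <= t <= M -> gamma <= r * (r - 1) * t `^ (r - 2).
      move=> tm; rewrite ler_wpM2l//; first by case: hr' => ?; nra.
      by have /andP[] := powR_bound (r - 2) m0 tm.
    rewrite qformB !qformZ lerBrDr D'E.
    have := op_powR_map_chord Phi1 Phi0 sA m0 mM specA hg y.
    by move=> /le_trans; apply; exact: chord_le_kantorovich_map.
  + by rewrite qformB !qformZ gerBl mulr_ge0.
- have hr' : r <= 0 \/ 1 <= r by case: hr => ?; [left|right]; lra.
  have [g0 h1 h2] := convex hr'; split=> //; apply: loewnerP => // y.
  exact: (op_powR_positive_map_le Phi1 Phi0 sA specA m0 mM).
(* For r in [0, 1] the power t^(r - 2) decreases, so its minimum over [m, M] is at [M]; this is the
   origin of M^(2 - r) in (iii). *)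
set c := r * (1 - r) * M `^ (r - 2).
have cE : r * (1 - r) / (2 * M `^ (2 - r)) = c / 2.
  by rewrite /c -[r - 2]opprB powRN; field; rewrite gt_eqF ?powR_gt0.
have rr : 0 <= r * (1 - r) by nra.
have c0 : 0 <= c / 2 by rewrite divr_ge0// mulr_ge0// powR_ge0.
have hc t : m <= t <= M -> c <= r * (1 - r) * t `^ (r - 2).
  move=> /andP[mt tM]; rewrite ler_wpM2l// le0_ler_powR//; last exact: lt_le_trans mt.
  by lra.
rewrite cE; split; apply: loewnerP => [||y] //;
  try by do ?[exact: selfadjointZ|apply: selfadjointZ|apply: selfadjointB].
- by rewrite !qformZ qformB qformZ ler_wpM2l// gerBl mulr_ge0.
- rewrite qformZ qformB qformZ kd' DE.
  apply: le_trans (chord_le_map_op_powR Phi1 Phi0 sA m0 mM specA hc y).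
  exact: kantorovich_le_chord_map.
- exact: (op_powR_positive_map_ge Phi1 Phi0 sA specA m0 mM).
Qed.
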